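(* Let $G$ be a group acting isometrically on two leafless trees $T_1$ and $T_2$, and assume that there is a $G$-equivariant bijective map $f : \partial_\infty T_1 \to \partial_\infty T_2$. If $T_1$ and $T_2$ are both locally finite and admit at least three ends, and $G$ acts two-transitively on $\partial_\infty T_1$, then there exists, after rescaling the metric on $T_2$ (i.e. multiplying it by some positive constant), an isometry $\bar{f}: T_1 \to T_2$ which induces the map $f$ on $\partial_\infty T_1$. This isometry is unique if $T_1$ has at least two branch points.
   Context: ''Tree'' means $\mathbb{R}$-tree: a metric space $(T,\mathsf{d})$ that is uniquely geodesic (any two points are joined by a unique geodesic segment) and such that, if two geodesic segments meet only at a common end-point, their union is a geodesic segment. A tree is leafless if it has extensible geodesics (every geodesic segment is contained in an isometrically embedded copy of $\mathbb{R}$). A ray is an embedded closed half-line; two rays are equivalent if they intersect in a ray; the equivalence classes are the ends of $T$, and $\partial_\infty T$ is the set of ends. Isometries of $T$ act on $\partial_\infty T$. Two rays starting at the same point $x\in T$ locally coincide if they intersect in more than just $x$; this is an equivalence relation on the rays starting at $x$, and the set of classes is the space of directions at $x$. The valency of $x$ is the cardinality of its space of directions. A branch point is a point of valency at least three. $T$ is locally finite if no point has infinite valency (this does not necessarily imply local compactness). Isometries between trees are bijective. *)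

(* Defs.v *)
From mathcomp Require Import all_boot all_order all_algebra.
From mathcomp Require Import all_classical all_reals all_analysis.

Set Implicit Arguments.
Unset Strict Implicit.
Unset Printing Implicit Defensive.

Local Open Scope classical_set_scope.
Local Open Scope ring_scope.
Local Open Scope card_scope.

Section Trees.
Context {R : realType} {T : metricType R}.
Implicit Types (x y : T) (A B S L : set T) (E : set (set T)).

(* Segments, rays and lines are subsets of T: the images of isometric
   embeddings of [0, l], [0, +oo[ and R. Values of a parametrization outside
   its domain D are irrelevant. *)
Definition isometric_on (D : set R) (p : R -> T) : Prop :=
  forall s t, D s -> D t -> mdist (p s) (p t) = `|s - t|.

Definition is_segment x y S : Prop :=
  exists p : R -> T,
    [/\ isometric_on `[0, mdist x y] p, p 0 = x, p (mdist x y) = y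
      & S = p @` `[0, mdist x y]].

Definition is_geodesic_segment S : Prop := exists x y, is_segment x y S.

Definition is_line L : Prop :=
  exists p : R -> T, isometric_on setT p /\ L = range p.

Definition is_ray_from x A : Prop :=
  exists p : R -> T,
    [/\ isometric_on `[0, +oo[ p, p 0 = x & A = p @` `[0, +oo[].

Definition is_ray A : Prop := exists x, is_ray_from x A.

Definition ray_equiv A B : Prop := is_ray (A `&` B).

Definition ends : set (set (set T)) :=
  [set E | exists2 A, is_ray A & E = [set B | is_ray B /\ ray_equiv A B]].

Definition locally_coincide x A B : Prop := A `&` B <> [set x].

Definition directions x : set (set (set T)) :=
  [set D | exists2 A, is_ray_from x A &
     D = [set B | is_ray_from x B /\ locally_coincide x A B]].

Definition branch_point x : Prop := `I_3 #<= directions x.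

End Trees.

Arguments ends {R} T.

Record is_tree (R : realType) (T : metricType R) : Prop := IsTree {
  tree_geodesic : forall x y : T, exists! S, is_segment x y S;
  tree_concat : forall (x y z : T) (S S' : set T),
    is_segment x y S -> is_segment y z S' -> S `&` S' = [set y] ->
    is_geodesic_segment (S `|` S')
}.

Definition leafless (R : realType) (T : metricType R) : Prop :=
  forall S : set T, is_geodesic_segment S -> exists2 L, is_line L & S `<=` L.

Definition tree_locally_finite (R : realType) (T : metricType R) : Prop :=
  forall x : T, finite_set (directions x).

Record is_isometric_action (G : groupType) (R : realType) (T : metricType R)
    (act : G -> T -> T) : Prop := IsIsometricAction {
  act_one : forall x, act 1%g x = x;
  act_mul : forall g h x, act (g * h)%g x = act g (act h x);
  act_mdist : forall g x y, mdist (act g x) (act g y) = mdist x y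
}.

(* The map on ends induced by a map of points: it sends a class of rays to the
   set of the images of these rays. *)
Definition end_map (T1 T2 : Type) (h : T1 -> T2) (E : set (set T1)) :
    set (set T2) :=
  [set h @` A | A in E].

Definition two_transitive_on_ends (G : groupType) (R : realType)
    (T : metricType R) (act : G -> T -> T) : Prop :=
  forall E1 E2 E1' E2' : set (set T),
    ends T E1 -> ends T E2 -> ends T E1' -> ends T E2' ->
    E1 <> E2 -> E1' <> E2' ->
    exists g, end_map (act g) E1 = E1' /\ end_map (act g) E2 = E2'.

(* The distances are arguments so that they can be rescaled. *)
Definition is_isometry (R : realType) (T1 T2 : Type)
    (d1 : T1 -> T1 -> R) (d2 : T2 -> T2 -> R) (h : T1 -> T2) : Prop :=
  bijective h /\ forall x y, d2 (h x) (h y) = d1 x y.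

Definition rescale (R : realType) (T : metricType R) (c : R) (x y : T) : R :=
  c * mdist x y.

(* An isometry onto a rescaled tree sends rays to rays, because rescaling does
   not change which subsets are rays. *)
Definition induces_on_ends (R : realType) (T1 T2 : metricType R)
    (h : T1 -> T2) (f : set (set T1) -> set (set T2)) : Prop :=
  forall E, ends T1 E -> end_map h E = f E.

(* Main.v *)
Require Import Defs.
From mathcomp Require Import all_boot all_order all_algebra all_fingroup.
From mathcomp Require Import all_classical all_reals all_analysis.
From mathcomp Require Import ring lra.

Import Order.TTheory GRing.Theory Num.Theory.

Local Open Scope classical_set_scope.
Local Open Scope ring_scope.
Local Open Scope card_scope.

Set Implicit Arguments.
Unset Strict Implicit.
Unset Printing Implicit Defensive.

(** An element [g] of the group that fixes an end [E] moves the points near [E]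
    by a signed length towards [E], its shift. An element with a nonzero shift
    is hyperbolic and fixes exactly two ends. Since [f] identifies the ends of
    the two trees, each stabilizer of an end has two shift homomorphisms, and
    the proof consists in showing that they are proportional with a positive
    factor ([shifts_proportional]), from which the trees are recovered.

    Proportionality. If it fails, some element [h] fixing two ends [U] and [A]
    translates towards [A] in the first tree and away from [A] in the second
    one. Take [s] fixing [A] with zero shifts, but moving [U]. In the second
    tree, the conjugates of [s] by the powers of [h] eventually fix any given
    branch point [x] of the line from [U] to [A]. There are finitely many
    directions at [x], so two of these conjugates [k] and [k'] act alike on
    them, and by Jordan's theorem on derangements some [g] fixes [x] but no
    direction at [x]. Hence [g * k^-1 * k'] fixes no end ([no_fixed_end]). In
    the first tree the same element, for [k'] far enough, is hyperbolic
    ([fixed_end]), which is absurd ([opposite_shifts_absurd]). If a tree has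
    only zero shifts, then it is a star with finitely many ends
    ([ends_finite_of_no_shift]), and then the other tree has only zero shifts
    too ([no_shift_of_ends_finite]).

    Reconstruction. For three ends [U], [A], [B], a product of three elements
    fixing [U], [B] and [A] respectively reflects the line from [U] to [A]. Its
    reflection point is determined by the projection of [B] to this line and
    the shifts of the factors ([reflection]). The product of two such
    reflections is a translation, whose lengths in the two trees are
    proportional; hence the projections of the ends to corresponding lines are
    proportional too ([projections_proportional]). So the lines of the two
    trees can be matched compatibly with their branching, and since any two
    points of a leafless tree lie on a line, this defines the homothety
    ([homothety_exists]). It is unique, as it maps the median of three ends to
    the median of their images, and as two medians determine the scaling
    ([homothety_uniq]). *)

(** [lra] on contradictory hypotheses in [R]. *)
Ltac lra_absurd R := exfalso; suff : (0 : R) < 0; [by rewrite ltxx|lra].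

(** * The four-point inequality *)

Section FourPoint.
Context {R : realType} {T : metricType R}.
Implicit Types (x y z w c : T) (p q : R -> T) (S : set T).

(** [p] restricted to [[0, l]] is an isometric embedding; comparing [s <= t]
    only avoids absolute values. *)
Definition geodesic_on (l : R) p : Prop :=
  forall s t, 0 <= s -> s <= t -> t <= l -> mdist (p s) (p t) = t - s.

(** A unit speed parametrization of the segment from [x] to [y]. *)
Definition geodesic x y p : Prop :=
  [/\ geodesic_on (mdist x y) p, p 0 = x & p (mdist x y) = y].

Lemma isometric_on_segmentE (l : R) p :
  isometric_on `[0, l] p <-> geodesic_on l p.
Proof.
split=> [iso s t s0 st tl|geo s t] /=.
  rewrite iso /= ?in_itv /=; try (by apply/andP; split; lra).
  by rewrite ler0_norm ?opprB//; lra.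
rewrite !in_itv /= => /andP[s0 sl] /andP[t0 tl].
case: (lerP s t) => st; first by rewrite geo// ler0_norm ?opprB//; lra.
by rewrite metric_sym geo ?ger0_norm//; lra.
Qed.

Lemma is_segmentE x y S :
  is_segment x y S <->
  exists2 p, geodesic x y p & S = p @` `[0, mdist x y].
Proof.
split=> [[p [/isometric_on_segmentE ? ? ? ?]]|[p [? ? ?] ?]]; exists p => //.
by split=> //; exact/isometric_on_segmentE.
Qed.

Lemma geodesic_sub x y p s t : geodesic x y p -> 0 <= s -> s <= t ->
  t <= mdist x y -> geodesic (p s) (p t) (fun r => p (s + r)).
Proof.
move=> [geo p0 pl] s0 st tl; rewrite /geodesic geo// addr0 (addrC s) subrK.
split=> // a b a0 ab bl; rewrite geo; lra.
Qed.

Lemma geodesic_rev x y p : geodesic x y p ->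
  geodesic y x (fun r => p (mdist x y - r)).
Proof.
move=> [geo p0 pl]; rewrite /geodesic metric_sym subr0 subrr; split=> //.
move=> a b a0 ab bl; rewrite metric_sym geo; lra.
Qed.

Lemma geodesic_glue x y z p q : geodesic x y p -> geodesic y z q ->
  mdist x z = mdist x y + mdist y z ->
  geodesic x z (fun t => if t <= mdist x y then p t else q (t - mdist x y)).
Proof.
move=> [geop p0 pl] [geoq q0 ql] xyz.
have xy0 := mdist_ge0 x y; have yz0 := mdist_ge0 y z.
rewrite /geodesic xyz xy0; split=> //; last first.
  case: ifP => [zle|_]; last by rewrite addrC addKr.
  have z0 : mdist y z = 0 by lra.
  by rewrite z0 addr0 pl; apply: mdist_positivity.
move=> s t s0 st tl.
case: (lerP t (mdist x y)) => txy; first by rewrite ifT ?geop//; lra.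
case: (lerP s (mdist x y)) => sxy; last by rewrite geoq; lra.
have e1 : mdist x (p s) = s by rewrite -{1}p0 geop; lra.
have e2 : mdist (p s) y = mdist x y - s by rewrite -{1}pl geop; lra.
have e3 : mdist y (q (t - mdist x y)) = t - mdist x y.
  by rewrite -{1}q0 geoq; lra.
have e4 : mdist (q (t - mdist x y)) z = mdist y z - (t - mdist x y).
  by rewrite -{1}ql geoq; lra.
have t1 := metric_triangle (p s) y (q (t - mdist x y)).
have t2 := metric_triangle x (p s) z.
have t3 := metric_triangle (p s) (q (t - mdist x y)) z.
lra.
Qed.

Context (tree : is_tree T).

Lemma geodesic_ex x y : exists p, geodesic x y p.
Proof.
by have [S [/is_segmentE[p gp _] _]] := tree_geodesic tree x y; exists p.
Qed.

Lemma geodesic_uniq x y p q : geodesic x y p -> geodesic x y q ->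
  forall t, 0 <= t -> t <= mdist x y -> p t = q t.
Proof.
move=> gp gq t t0 tl.
have [S [_ uS]] := tree_geodesic tree x y.
have Sp : S = p @` `[0, mdist x y] by apply/uS/is_segmentE; exists p.
have Sq : S = q @` `[0, mdist x y] by apply/uS/is_segmentE; exists q.
have : (q @` `[0, mdist x y]) (p t).
  by rewrite -Sq Sp; exists t => //=; rewrite in_itv /= t0.
move=> [s /=]; rewrite in_itv /= => /andP[s0 sl] qs.
suff ts : t = s by rewrite -qs ts.
case: gp gq => [gp p0 _] [gq q0 _].
have : mdist x (p t) = mdist x (q s) by rewrite qs.
by rewrite -{1}p0 -{1}q0 gp// gq//; lra.
Qed.

Lemma between_in_segment x y z S :
  mdist x z = mdist x y + mdist y z -> is_segment x z S -> S y.
Proof.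
move=> xyz xzS.
have [p gp] := geodesic_ex x y; have [q gq] := geodesic_ex y z.
have gpq := geodesic_glue gp gq xyz.
have [S' [_ uS]] := tree_geodesic tree x z.
rewrite -(uS _ xzS) (uS _ (iffRL (is_segmentE _ _ _) (ex_intro2 _ _ _ gpq erefl))).
have xy0 := mdist_ge0 x y; have yz0 := mdist_ge0 y z.
exists (mdist x y); first by rewrite /= in_itv /=; apply/andP; split; lra.
by rewrite lexx; case: gp.
Qed.

(** The union of the two segments is a segment, and unique geodesics force their
    common endpoint to lie between the other two endpoints. *)
Lemma segments_meet_at_endpoint x y z S S' :
  is_segment x y S -> is_segment y z S' -> S `&` S' = [set y] ->
  mdist x z = mdist x y + mdist y z.
Proof.
move=> xyS yzS' SS'.
have [a [b [p [iso _ _ SSE]]]] := tree_concat tree xyS yzS' SS'.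
have inS (u v : T) V : is_segment u v V -> V u /\ V v.
  move=> [q [_ q0 ql ->]]; have uv0 := mdist_ge0 u v.
  by split; [exists 0|exists (mdist u v)]; rewrite //= in_itv /= ?lexx ?uv0.
have [Sx Sy] := inS _ _ _ xyS; have [S'y S'z] := inS _ _ _ yzS'.
have xS' : S' x -> x = y by move=> S'x; have : (S `&` S') x by []; rewrite SS'.
have zS : S z -> z = y by move=> Sz; have : (S `&` S') z by []; rewrite SS'.
have yxS : is_segment y x S.
  move/is_segmentE : xyS => [q gq ->]; apply/is_segmentE.
  exists (fun r => q (mdist x y - r)); first exact: geodesic_rev.
  have yxE := metric_sym y x.
  apply/seteqP; split=> v [t /=]; rewrite in_itv /= => /andP[t0 tl] <-;
    exists (mdist x y - t) => /=.
  - by rewrite in_itv /=; apply/andP; split; lra.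
  - by rewrite opprB addrC subrK.
  - by rewrite in_itv /=; apply/andP; split; lra.
  - by [].
have im v : (S `|` S') v -> exists2 t, `[0, mdist a b]%classic t & p t = v.
  by rewrite SSE => -[t Dt <-]; exists t.
have [r Dr xE] := im x (or_introl Sx).
have [s Ds yE] := im y (or_introl Sy).
have [t Dt zE] := im z (or_intror S'z).
have xy : mdist x y = `|r - s| by rewrite -xE -yE iso.
have yx : mdist y x = `|r - s| by rewrite metric_sym.
have yz : mdist y z = `|s - t| by rewrite -yE -zE iso.
have xz : mdist x z = `|r - t| by rewrite -xE -zE iso.
have zx : mdist z x = `|r - t| by rewrite metric_sym.
have xin : mdist y z = mdist y x + mdist x z -> x = y.
  by move=> /between_in_segment /(_ yzS') /xS'.
have zin : mdist y x = mdist y z + mdist z x -> z = y.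
  by move=> /between_in_segment /(_ yxS) /zS.
have done1 : x = y -> mdist x z = mdist x y + mdist y z.
  by move=> ->; rewrite mdistxx add0r.
have done2 : z = y -> mdist x z = mdist x y + mdist y z.
  by move=> ->; rewrite mdistxx addr0.
move: xin zin done1 done2; rewrite xy yx yz xz zx.
case: (lerP r s) => rs; case: (lerP s t) => ts; case: (lerP r t) => rt;
  move=> xin zin done1 done2;
  by first [lra|apply: done1; apply: xin; lra|apply: done2; apply: zin; lra].
Qed.

(** Two geodesics from [x] coincide exactly up to the median of their
    endpoints and [x]: behind that point they only meet in it. *)
Lemma geodesic_fork x y z p q : geodesic x y p -> geodesic x z q ->
  exists m, [/\ 0 <= m, m <= mdist x y, m <= mdist x z,
    forall t, 0 <= t -> t <= m -> p t = q t
    & mdist y z = mdist x y + mdist x z - 2 * m].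
Proof.
move=> gp gq; have [geop p0 pl] := gp; have [geoq q0 ql] := gq.
have xy0 := mdist_ge0 x y; have xz0 := mdist_ge0 x z.
pose E := [set t | [/\ 0 <= t, t <= mdist x y, t <= mdist x z & p t = q t]].
have E0 : E 0 by split=> //; rewrite p0 q0.
have supE : has_sup E by split; [exists 0|exists (mdist x y) => t []].
pose m := sup E.
have m0 : 0 <= m by exact: sup_upper_bound E0.
have my : m <= mdist x y by apply: ge_sup => [|t []//]; exists 0.
have mz : m <= mdist x z by apply: ge_sup => [|t []//]; exists 0.
have pqm : p m = q m.
  apply: mdist_positivity; apply/eqP; rewrite eq_le mdist_ge0 andbT.
  rewrite leNgt; apply/negP => e0.
  have e2 : 0 < mdist (p m) (q m) / 2 by lra.
  have [t Et tm] := sup_adherent e2 supE.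
  have t_le : t <= m by exact: sup_upper_bound Et.
  case: Et => t0 ty tz pqt; rewrite -/m in tm.
  have tr := metric_triangle (p m) (p t) (q m).
  have d1 : mdist (p m) (p t) = m - t by rewrite metric_sym geop.
  have d2 : mdist (p t) (q m) = m - t by rewrite pqt geoq.
  lra_absurd R.
have dpm : mdist x (p m) = m by rewrite -{1}p0 geop; lra.
have pqE t : 0 <= t -> t <= m -> p t = q t.
  move=> t0 tm.
  have g1 := geodesic_sub gp (lexx 0) m0 my.
  have g2 := geodesic_sub gq (lexx 0) m0 mz.
  rewrite p0 in g1; rewrite q0 -pqm in g2.
  have := geodesic_uniq g1 g2 t0; rewrite dpm => /(_ tm).
  by rewrite !add0r.
exists m; split=> //.
have g1 := geodesic_rev (geodesic_sub gp m0 my (lexx _)).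
have g2 := geodesic_sub gq m0 mz (lexx _).
rewrite pl in g1; rewrite ql -pqm in g2.
have dy : mdist (p m) y = mdist x y - m by rewrite -{1}pl geop; lra.
have dz : mdist (p m) z = mdist x z - m by rewrite pqm -{1}ql geoq; lra.
have s1 := iffRL (is_segmentE _ _ _) (ex_intro2 _ _ _ g1 erefl).
have s2 := iffRL (is_segmentE _ _ _) (ex_intro2 _ _ _ g2 erefl).
rewrite (segments_meet_at_endpoint s1 s2) ?(metric_sym y) ?dy ?dz; first lra.
have dpE t : 0 <= t -> t <= mdist x y -> mdist x (p t) = t.
  by move=> t0 ty; rewrite -{1}p0 geop; lra.
have dqE t : 0 <= t -> t <= mdist x z -> mdist x (q t) = t.
  by move=> t0 tz; rewrite -{1}q0 geoq; lra.
apply/seteqP; split=> [v [] [s /=]|v ->].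
  rewrite in_itv /= => /andP[s0 sl] pv [t /=].
  rewrite in_itv /= => /andP[t0 tl] qv.
  set s' := m + _ in pv.
  have s'0 : m <= s' by rewrite /s'; lra.
  have s'l : s' <= mdist x y by rewrite /s'; lra.
  have st : s' = m + t.
    have := dpE s'; rewrite pv -qv => <-; try lra.
    by rewrite dqE; lra.
  suff e : s' = m by rewrite /= -pv e.
  apply/eqP; rewrite eq_le s'0 andbT; apply: sup_upper_bound => //.
  by split; [lra|lra|lra|rewrite pv -qv st].
split; [exists (mdist x y - m)|exists 0] => /=.
- by rewrite in_itv /=; apply/andP; split; lra.
- by congr p; lra.
- by rewrite in_itv /=; apply/andP; split; lra.
- by rewrite addr0.
Qed.

(** Trees are 0-hyperbolic. *)
Lemma four_point x y z w :
  mdist x y + mdist z w <= mdist x z + mdist y w \/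
  mdist x y + mdist z w <= mdist x w + mdist y z.
Proof.
have [p gp] := geodesic_ex w x; have [q gq] := geodesic_ex w y.
have [r gr] := geodesic_ex w z.
have [m [m0 mx my _ dxy]] := geodesic_fork gp gq.
have [n [n0 nx nz pr dxz]] := geodesic_fork gp gr.
have [k [k0 ky kz qr dyz]] := geodesic_fork gq gr.
have wx := metric_sym w x; have wy := metric_sym w y.
have wz := metric_sym w z.
have mE t : 0 <= t -> t <= n -> t <= k -> t <= m.
  move=> t0 tn tk.
  have pq : p t = q t by rewrite pr// qr.
  case: gp gq => geop p0 pl [geoq q0 ql].
  have tr := metric_triangle x (p t) y.
  have d1 : mdist (p t) x = mdist w x - t by rewrite -{1}pl geop; lra.
  have d2 : mdist (p t) y = mdist w y - t by rewrite pq -{1}ql geoq; lra.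
  rewrite (metric_sym x (p t)) in tr; lra.
case: (lerP n k) => nk.
  by left; have := mE n n0 (lexx n) nk; lra.
by right; have := mE k k0 (ltW nk) (lexx k); lra.
Qed.

End FourPoint.

(** * Rays and lines *)

Section Rays.
Context {R : realType} {T : metricType R}.
Implicit Types (x y z w : T) (p q r L : R -> T) (c : R).

(** A unit speed parametrization of a ray; the values of [p] at negative numbers
    are irrelevant. *)
Definition ray p : Prop :=
  forall s t, 0 <= s -> s <= t -> mdist (p s) (p t) = t - s.

Definition line L : Prop := forall s t, s <= t -> mdist (L s) (L t) = t - s.

(** [p] and [q] eventually coincide, up to the translation by [c] of the
    parameter. *)
Definition asymptotic c p q : Prop :=
  exists M, forall t, M <= t -> p t = q (t + c).

Lemma line_ray L : line L -> ray L.
Proof. by move=> lL s t _; exact: lL. Qed.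

Lemma line_rev L : line L -> line (fun t => L (- t)).
Proof. by move=> lL s t st; rewrite metric_sym lL; lra. Qed.

Lemma line_shift L c : line L -> line (fun t => L (t + c)).
Proof. by move=> lL s t st; rewrite lL; lra. Qed.

Lemma ray_shift p c : 0 <= c -> ray p -> ray (fun t => p (t + c)).
Proof. by move=> c0 rp s t s0 st; rewrite rp; lra. Qed.

Lemma ray_inj p s t : ray p -> 0 <= s -> 0 <= t -> p s = p t -> s = t.
Proof.
move=> rp s0 t0 pst.
have := mdistxx (p s); rewrite {2}pst; case: (lerP s t) => st.
  by rewrite rp//; lra.
by rewrite metric_sym rp; lra.
Qed.

Lemma line_inj L s t : line L -> L s = L t -> s = t.
Proof.
move=> lL Lst; have := mdistxx (L s); rewrite {2}Lst; case: (lerP s t) => st.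
  by rewrite lL//; lra.
by rewrite metric_sym lL; lra.
Qed.

Lemma asymptotic_refl p : asymptotic 0 p p.
Proof. by exists 0 => t _; rewrite addr0. Qed.

Lemma asymptotic_sym c p q : asymptotic c p q -> asymptotic (- c) q p.
Proof.
by move=> [M pq]; exists (M + c) => t Mt; rewrite pq ?subrK//; lra.
Qed.

Lemma asymptotic_trans c c' p q r :
  asymptotic c p q -> asymptotic c' q r -> asymptotic (c + c') p r.
Proof.
move=> [M pq] [N qr]; exists (Num.max M (N - c)) => t.
by rewrite ge_max => /andP[Mt Nt]; rewrite pq// qr ?addrA//; lra.
Qed.

Lemma asymptotic_uniq c c' p q :
  ray q -> asymptotic c p q -> asymptotic c' p q -> c = c'.
Proof.
move=> rq [M pq] [N pq'].
pose t := Num.max (Num.max M N) (Num.max (- c) (- c')).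
have tt : t <= t by [].
move: tt; rewrite {1}/t !ge_max => /andP[/andP[Mt Nt] /andP[ct ct']].
have := @ray_inj q (t + c) (t + c') rq ltac:(lra) ltac:(lra).
by rewrite -pq// -pq'// => /(_ erefl); lra.
Qed.

Lemma asymptotic_shift c p : asymptotic c (fun t => p (t + c)) p.
Proof. by exists 0. Qed.

Lemma ray_geodesic p s : ray p -> 0 <= s -> geodesic (p 0) (p s) p.
Proof.
move=> rp s0; rewrite /geodesic rp// subr0; split=> // a b a0 ab _.
exact: rp.
Qed.

Lemma line_of_rays p q : ray p -> ray q ->
  (forall s t, 0 <= s -> 0 <= t -> mdist (p s) (q t) = s + t) ->
  line (fun t => if t <= 0 then p (- t) else q t).
Proof.
move=> rp rq pq s t st /=.
case: (lerP t 0) => t0; first by rewrite ifT ?(metric_sym (p (- s))) ?rp; lra.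
case: (lerP s 0) => s0; first by rewrite pq; lra.
by rewrite rq; lra.
Qed.

Context (tree : is_tree T).

(** A point between [x] and [y] is determined by its distances to them. *)
Lemma between_uniq x y z z' : mdist x z = mdist x z' ->
  mdist x z + mdist z y = mdist x y -> mdist x z' + mdist z' y = mdist x y ->
  z = z'.
Proof.
move=> xz xzy xzy'; apply: mdist_positivity.
have := four_point tree z z' x y; have := mdist_ge0 z z'.
by rewrite !(metric_sym _ x) => ? [?|?]; lra.
Qed.

Lemma ray_from p : ray p ->
  forall x, exists q c, [/\ ray q, q 0 = x & asymptotic c q p].
Proof.
move=> rp x; pose D := mdist x (p 0); have D0 : 0 <= D := mdist_ge0 _ _.
pose M := D + 1; pose m := (D + M - mdist x (p M)) / 2.
have DM : D < M by rewrite /M; lra.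
have pd s t : 0 <= s -> s <= t -> mdist (p s) (p t) = t - s by exact: rp.
have p0M := pd 0 M (lexx 0) ltac:(lra).
have mD : m <= D.
  by have := metric_triangle (p 0) x (p M); rewrite (metric_sym _ x) /m -/D; lra.
have m0 : 0 <= m.
  by have := metric_triangle x (p 0) (p M); rewrite /m -/D; lra.
have xM : mdist x (p M) = D + M - 2 * m by rewrite /m; lra.
have xm : mdist x (p m) = D - m.
  have p0m := pd 0 m (lexx 0) m0; have pmM := pd m M m0 ltac:(lra).
  have := metric_triangle x (p m) (p 0).
  have := four_point tree x (p m) (p 0) (p M).
  by rewrite (metric_sym (p m) (p 0)) -/D => -[?|?] ?; lra.
have xt t : m <= t -> mdist x (p t) = mdist x (p m) + (t - m).
  move=> mt; rewrite xm; have pmt := pd m t m0 mt.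
  have tr := metric_triangle x (p m) (p t).
  case: (lerP t M) => tM.
    have ptM := pd t M ltac:(lra) tM.
    by have := metric_triangle x (p t) (p M); lra.
  have p0t := pd 0 t (lexx 0) ltac:(lra).
  have pMt := pd M t ltac:(lra) (ltW tM).
  have := four_point tree x (p M) (p 0) (p t).
  by rewrite (metric_sym (p M) (p 0)) -/D => -[?|?]; lra.
have l0 := mdist_ge0 x (p m); set l := mdist x (p m) in xt l0.
have [g [gg g0 gl]] := geodesic_ex tree x (p m); rewrite -/l in gg gl.
exists (fun t => if t <= l then g t else p (t - l + m)), (m - l).
split; last 2 first.
- by rewrite l0.
- exists l => t lt; case: (lerP t l) => tl.
    have -> : t = l by lra.
    by rewrite gl; congr p; lra.
  by congr p; lra.
move=> s t s0 st /=; case: (lerP t l) => tl; first by rewrite ifT ?gg//; lra.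
case: (lerP s l) => sl; last by rewrite pd; lra.
have e1 : mdist x (g s) = s by rewrite -{1}g0 gg; lra.
have e2 : mdist (g s) (p m) = l - s by rewrite -{1}gl gg; lra.
have e3 := pd m (t - l + m) m0 ltac:(lra).
have e4 := xt (t - l + m) ltac:(lra).
have := metric_triangle (g s) (p m) (p (t - l + m)).
by have := metric_triangle x (g s) (p (t - l + m)); lra.
Qed.

(** Two rays from the same point coincide, or they separate at one point and
    never meet again. *)
Lemma fork_rays p q : ray p -> ray q -> p 0 = q 0 ->
  (forall t, 0 <= t -> p t = q t) \/
  exists m, [/\ 0 <= m, forall t, 0 <= t -> t <= m -> p t = q t
    & forall s t, m <= s -> m <= t -> mdist (p s) (q t) = s + t - 2 * m].
Proof.
move=> rp rq pq0; have [|nE] := pselect (forall t, 0 <= t -> p t = q t).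
  by left.
right; have [a a0 pqa] : exists2 a, 0 <= a & p a <> q a.
  apply: contrapT => H; apply: nE => t t0; apply: contrapT => pqt.
  by apply: H; exists t.
have fork s t : 0 <= s -> 0 <= t -> exists m, [/\ 0 <= m, m <= s, m <= t,
    forall u, 0 <= u -> u <= m -> p u = q u & mdist (p s) (q t) = s + t - 2 * m].
  move=> s0 t0; have gp := ray_geodesic rp s0; have gq := ray_geodesic rq t0.
  rewrite -pq0 in gq; have [m [m0 ms mt pq dpq]] := geodesic_fork tree gp gq.
  have ps := rp 0 s (lexx 0) s0; have qt := rq 0 t (lexx 0) t0.
  by rewrite -pq0 in qt; exists m; split=> //; lra.
have [m [m0 ma _ pq dpq]] := fork a a a0 a0.
exists m; split=> // s t ms mt.
have [n [n0 ns nt pq' dpq']] := fork s t (le_trans m0 ms) (le_trans m0 mt).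
rewrite dpq'; case: (ltrgtP m n) => [mn|nm|->//].
  have agree u : 0 <= u -> u <= n -> u <= a -> u <= m.
    move=> u0 un ua; have := metric_triangle (p a) (p u) (q a).
    by rewrite {2}(pq' u)// (metric_sym (p a) (p u)) rp// rq//; lra.
  case: (lerP n a) => na; first by have := agree n n0 (lexx n) na; lra.
  by case: pqa; apply: pq' => //; exact: ltW.
have := metric_triangle (p s) (p m) (q t).
by rewrite {2}(pq m)// (metric_sym (p s) (p m)) rp// rq//; lra.
Qed.

Lemma rays_line p q : ray p -> ray q -> (forall c, ~ asymptotic c p q) ->
  exists L, [/\ line L, exists c, asymptotic c (fun t => L (- t)) p
    & exists c, asymptotic c L q].
Proof.
move=> rp rq npq.
have [q' [c [rq' q'0 q'q]]] := ray_from rq (p 0).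
have [E|[m [m0 E dpq]]] := fork_rays rp rq' (esym q'0).
  case: (npq (0 + c)); apply: asymptotic_trans q'q; exists 0 => t t0.
  by rewrite addr0 E.
exists (fun t => if t <= 0 then p (- t + m) else q' (t + m)); split.
- apply: (@line_of_rays (fun t => p (t + m)) (fun t => q' (t + m))).
  + exact: ray_shift.
  + exact: ray_shift.
  + by move=> s t s0 t0; rewrite dpq; lra.
- exists m, 1 => t t1; rewrite ifT ?opprK//; lra.
- exists (m + c); apply: asymptotic_trans q'q.
  by exists 1 => t t1; rewrite ifF//; apply/negbTE; rewrite -ltNge; lra.
Qed.

Lemma line_uniq c c' L L' : line L -> line L' -> asymptotic c L L' ->
  asymptotic c' (fun t => L (- t)) (fun t => L' (- t)) ->
  forall t, L t = L' (t + c).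
Proof.
move=> lL lL' [M LL'] [N LL'n] t.
pose u := Num.max (Num.max M t) (Num.max N (- t)).
have : u <= u by [].
rewrite {1}/u !ge_max => /andP[/andP[Mu tu] /andP[Nu tu']].
pose v := u + `|c| + `|c'|.
have cc : - `|c| <= c <= `|c| by rewrite -ler_norml.
have cc' : - `|c'| <= c' <= `|c'| by rewrite -ler_norml.
have [c0 c'0] := (normr_ge0 c, normr_ge0 c').
have e1 := LL' v ltac:(rewrite /v; lra).
have e2 := LL'n v ltac:(rewrite /v; lra).
have d1 := lL (- v) v ltac:(rewrite /v; lra).
have d2 := lL' (- (v + c')) (v + c) ltac:(rewrite /v; lra).
rewrite -e1 -e2 in d2.
have d3 := lL (- v) t ltac:(rewrite /v; lra).
have d4 := lL t v ltac:(rewrite /v; lra).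
have d5 := lL' (- (v + c')) (t + c) ltac:(rewrite /v; lra).
have d6 := lL' (t + c) (v + c) ltac:(rewrite /v; lra).
rewrite -e1 in d6; rewrite -e2 in d5.
by apply: (@between_uniq (L (- v)) (L v)); lra.
Qed.

(** The ray [r] starts at the point [L a] and is opposite to both halves of the
    line [L] at this point. *)
Definition branches_at L r (a : R) : Prop :=
  r 0 = L a /\ forall s t, 0 <= s -> 0 <= t ->
    mdist (r s) (L (a + t)) = s + t /\ mdist (r s) (L (a - t)) = s + t.

(** A ray to an end not on [L] is asymptotic to a ray that starts on [L] and
    leaves it at once. *)
Lemma ray_branch L q : line L -> ray q -> (forall c, ~ asymptotic c q L) ->
  (forall c, ~ asymptotic c q (fun t => L (- t))) ->
  exists a r, [/\ ray r, exists c, asymptotic c r q & branches_at L r a].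
Proof.
move=> lL rq nqL nqL'.
have [r [c [rr r0 rq']]] := ray_from rq (L 0).
have main K : line K -> K 0 = L 0 -> (forall c, ~ asymptotic c q K) ->
    (forall s t, 0 <= s -> 0 <= t -> mdist (r s) (K (- t)) = s + t) ->
    exists2 a, 0 <= a & ray (fun t => r (t + a)) /\
      branches_at K (fun t => r (t + a)) a.
  move=> lK K0 nqK orth.
  have [E|[m [m0 E dr]]] := fork_rays rr (line_ray lK) (etrans r0 (esym K0)).
    case: (nqK (- c + 0)); apply: asymptotic_trans (asymptotic_sym rq') _.
    by exists 0 => t t0; rewrite addr0 E.
  exists m => //; split; first exact: ray_shift.
  split=> [|s t s0 t0]; first by rewrite add0r E.
  split; first by rewrite dr; lra.
  case: (lerP t m) => tm.
    by rewrite -E ?(metric_sym (r (s + m))) ?rr; lra.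
  have -> : m - t = - (t - m) by lra.
  by rewrite orth; lra.
have asym a : 0 <= a -> exists c, asymptotic c (fun t => r (t + a)) q.
  by move=> a0; exists (a + c); apply: asymptotic_trans (asymptotic_shift _ _) rq'.
have L00 : L (- 0) = L 0 by rewrite oppr0.
have [E|[m [m0 E dr]]] :=
    fork_rays rr (line_ray (line_rev lL)) (etrans r0 (esym L00)).
  case: (nqL' (- c + 0)); apply: asymptotic_trans (asymptotic_sym rq') _.
  by exists 0 => t t0; rewrite addr0 E.
case: (ltrP 0 m) => m1; last first.
  have orth s t : 0 <= s -> 0 <= t -> mdist (r s) (L (- t)) = s + t.
    by move=> s0 t0; rewrite dr; lra.
  have [a a0 [ra ba]] := main L lL erefl nqL orth.
  by exists a, (fun t => r (t + a)); split=> //; exact: asym.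
have orth s t : 0 <= s -> 0 <= t -> mdist (r s) (L (- - t)) = s + t.
  move=> s0 t0; rewrite opprK.
  have [E'|[n [n0 E' dr']]] := fork_rays rr (line_ray lL) r0.
    have := lL (- m) m ltac:(lra).
    by rewrite -E// -E'// mdistxx; lra.
  case: (ltrP 0 n) => n1; last by rewrite dr'; lra.
  case: (lerP m n) => mn.
    by have := lL (- m) m ltac:(lra); rewrite -E// -E'// mdistxx; lra.
  have nm : n <= m by lra.
  by have := lL (- n) n ltac:(lra); rewrite -E// -E'// mdistxx; lra.
have [a a0 [ra [ba1 ba2]]] :=
  main (fun t => L (- t)) (line_rev lL) L00 nqL' orth.
exists (- a), (fun t => r (t + a)); split=> //; first exact: asym.
split=> // s t s0 t0; have [e1 e2] := ba2 s t s0 t0.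
by split; [rewrite -e2|rewrite -e1]; do 2 f_equal; lra.
Qed.

Lemma branches_at_uniq L r r' a a' c : line L -> ray r -> ray r' ->
  asymptotic c r r' -> branches_at L r a -> branches_at L r' a' -> a = a'.
Proof.
wlog aa' : r r' a a' c / a <= a'.
  move=> H lL rr rr' rrE ba ba'; case: (lerP a a') => aa'.
    exact: H aa' lL rr rr' rrE ba ba'.
  by apply/esym; apply: H (ltW aa') lL rr' rr (asymptotic_sym rrE) ba' ba.
move=> lL rr rr' [M rrE] [ba1 ba2] [ba1' ba2'].
pose u := Num.max (Num.max M 0) (Num.max (- c) 0).
have : u <= u by [].
rewrite {1}/u !ge_max => /andP[/andP[Mu u0] /andP[cu _]].
have E := rrE u Mu; have uc : 0 <= u + c by lra.
have [e1 _] := ba2 u 0 u0 (lexx 0).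
have [e2 _] := ba2 u (a' - a) u0 ltac:(lra).
have [e3 _] := ba2' (u + c) 0 uc (lexx 0).
have [_ e4] := ba2' (u + c) (a' - a) uc ltac:(lra).
rewrite -E in e3 e4; rewrite addr0 in e1; rewrite addr0 in e3.
have f1 : a + (a' - a) = a' by lra.
have f2 : a' - (a' - a) = a by lra.
by rewrite f1 in e2; rewrite f2 in e4; lra.
Qed.

Lemma rays_diverge p q : ray p -> ray q -> (forall c, ~ asymptotic c p q) ->
  exists C M, forall s t, M <= s -> M <= t -> mdist (p s) (q t) = s + t + C.
Proof.
move=> rp rq /(rays_line rp rq)[L].
move=> [lL [c /asymptotic_sym[M pL]] [c' /asymptotic_sym[N qL]]].
exists (- c - c'), (Num.max (Num.max M N) (Num.max c c')) => s t.
rewrite !ge_max => /andP[/andP[Ms Ns] /andP[cs cs']].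
move=> /andP[/andP[Mt Nt] /andP[ct ct']].
by rewrite pL// qL// lL; lra.
Qed.

(** Two lines with a common end and different other ends separate at one
    point. *)
Lemma lines_split L L' : line L -> line L' -> asymptotic 0 L L' ->
  (forall c, ~ asymptotic c (fun t => L (- t)) (fun t => L' (- t))) ->
  exists a, (forall t, a <= t -> L t = L' t) /\
    forall s t, s <= a -> t <= a -> mdist (L s) (L' t) = (a - s) + (a - t).
Proof.
move=> lL lL' [M LL'] nLL'.
have rev K : line K -> ray (fun t => K (M - t)).
  by move=> lK s t s0 st; rewrite metric_sym lK; lra.
have rec K t : K t = K (M - (M - t)) :> T by congr K; lra.
have LM : L (M - 0) = L' (M - 0) by rewrite subr0 LL' ?addr0.
have [E|[m [m0 E dr]]] := fork_rays (rev _ lL) (rev _ lL') LM.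
  case: (nLL' 0); exists (- M) => t Mt; rewrite addr0.
  by rewrite rec E -?rec//; lra.
exists (M - m); split=> [t mt|s t sm tm].
  case: (lerP M t) => Mt; first by rewrite LL' ?addr0.
  by rewrite rec E -?rec//; lra.
by rewrite (rec L) (rec L') dr; lra.
Qed.

(** If [P], [h P] and [h (h P)] lie on a geodesic in this order, then the
    translates of [[P, h P]] by the powers of [h] form a ray. *)
Lemma translation_ray (h : T -> T) P :
  (forall x y, mdist (h x) (h y) = mdist x y) -> 0 < mdist P (h P) ->
  mdist P (h (h P)) = 2 * mdist P (h P) ->
  exists r, [/\ ray r, r 0 = P
    & forall t, 0 <= t -> h (r t) = r (t + mdist P (h P))].
Proof.
move=> iso; set l := mdist P (h P) => l0 l2.
pose x n := iter n h P.
have shift n k : mdist (x n) (x (n + k)%N) = mdist P (x k).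
  by elim: n => [|n IH] //; rewrite addSn /x !iterS iso.
have dx k : mdist P (x k) = k%:R * l /\ mdist P (x k.+1) = k.+1%:R * l.
  elim: k => [|k [IH1 IH2]]; first by rewrite mdistxx mul0r mul1r.
  split=> //; case: k IH1 IH2 => [|k] IH1 IH2; first exact: l2.
  have := four_point tree P (x k.+2) (x 1%N) (x k.+3).
  have := metric_triangle P (x 1%N) (x k.+3).
  have -> : mdist (x 1%N) (x k.+3) = mdist P (x k.+2) by rewrite -(shift 1%N).
  have -> : mdist (x k.+2) (x k.+3) = mdist P (x 1%N).
    by rewrite -(shift k.+2) addn1.
  have -> : mdist (x k.+2) (x 1%N) = mdist P (x k.+1).
    by rewrite metric_sym -(shift 1%N).
  have x1 : mdist P (x 1%N) = l by [].
  rewrite IH1 IH2 ?x1 -!natr1.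
  have : 0 <= k%:R :> R by rewrite ler0n.
  move: (k%:R : R) => K K0.
  have : 0 <= K * l by rewrite mulr_ge0// ltW.
  by move=> Kl tr [?|?]; lra.
have {}dx k : mdist P (x k) = k%:R * l by case: (dx k).
have dxx n N : (n <= N)%N -> mdist (x n) (x N) = N%:R * l - n%:R * l.
  by move=> nN; rewrite -(subnKC nN) shift dx natrD; lra.
have big t : exists N, t <= N%:R * l.
  exists (Num.truncn `|t / l|).+1; rewrite -ler_pdivrMr//.
  by rewrite (le_trans (ler_norm _))// ltW// truncnS_gt.
pose good t z := mdist P z = t /\
  exists N, t <= N%:R * l /\ mdist z (x N) = N%:R * l - t.
have goodS t z N : good t z -> exists N', (N <= N')%N /\
    t <= N'%:R * l /\ mdist z (x N') = N'%:R * l - t.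
  move=> [zt [n [tn zn]]]; exists (maxn n N); split; first exact: leq_maxr.
  have nN := leq_maxl n N; have dd := dxx _ _ nN.
  have dN := dx (maxn n N); have tr1 := metric_triangle z (x n) (x (maxn n N)).
  have tr2 := metric_triangle P z (x (maxn n N)).
  have : n%:R * l <= (maxn n N)%:R * l by rewrite ler_wpM2r ?ler_nat// ltW.
  by move=> ?; split; lra.
have good_uniq t z z' : good t z -> good t z' -> z = z'.
  move=> gz gz'; have [zt _] := gz; have [zt' _] := gz'.
  have [N [_ [tN zN]]] := goodS _ _ 0%N gz.
  have [N' [NN' [tN' zN']]] := goodS _ _ N gz'.
  have dN := dx N; have dN' := dx N'; have dd := dxx _ _ NN'.
  have tr := metric_triangle z (x N) (x N').
  have tr' := metric_triangle P z (x N').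
  by apply: (@between_uniq P (x N')); lra.
have seg N : exists g, forall s t, 0 <= s -> s <= t -> t <= N%:R * l ->
    [/\ good s (g s), good t (g t) & mdist (g s) (g t) = t - s].
  have [g [gg g0 gl]] := geodesic_ex tree P (x N).
  rewrite dx in gg gl; exists g => s t s0 st tN.
  have gd u : 0 <= u -> u <= N%:R * l -> good u (g u).
    move=> u0 uN; split; first by rewrite -{1}g0 gg; lra.
    by exists N; split=> //; rewrite -gl gg; lra.
  by split; [apply: gd; lra|apply: gd; lra|rewrite gg].
have ex t : exists z, 0 <= t -> good t z.
  case: (lerP 0 t) => t0; last by exists P.
  have [N tN] := big t; have [g gd] := seg N; exists (g t) => _.
  by case: (gd t t t0 (lexx t) tN).
have [r rP] := choice ex.
exists r; split.
- move=> s t s0 st; have [N tN] := big t; have [g gd] := seg N.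
  have [gs gt <-] := gd s t s0 st tN; have t0 := le_trans s0 st.
  by rewrite (good_uniq _ _ _ (rP s s0) gs) (good_uniq _ _ _ (rP t t0) gt).
- by apply/esym/mdist_positivity; have [] := rP 0 (lexx 0).
- move=> t t0; have tl0 : 0 <= t + l by lra.
  apply: (good_uniq (t + l)); last exact: rP.
  have [N [_ [tN zN]]] := goodS _ _ 0%N (rP t t0); have [Pt _] := rP t t0.
  have dN := dx N.+1; rewrite -natr1 in dN.
  have zN1 : mdist (h (r t)) (x N.+1) = N%:R * l - t by rewrite /x iterS iso.
  have tr1 := metric_triangle P (h P) (h (r t)); rewrite iso -/l in tr1.
  have tr2 := metric_triangle P (h (r t)) (x N.+1).
  split; first lra.
  by exists N.+1; rewrite -natr1; split; lra.
Qed.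

End Rays.

(** * Groups acting on a tree and on its ends *)

(** The type [X] models the set of ends of [T]: [conv p E] says that the ray
    [p] lies in the class [E]. The same [X] serves for two trees whose ends are
    in an equivariant bijection. *)
Record boundary (R : realType) (T : metricType R) (G : groupType) (X : Type)
    (actX : G -> X -> X) (act : G -> T -> T)
    (conv : (R -> T) -> X -> Prop) : Prop := Boundary {
  bd_tree : is_tree T;
  bd_act : is_isometric_action act;
  conv_ray : forall p E, conv p E -> ray p;
  conv_ex : forall E, exists p, conv p E;
  ray_conv : forall p, ray p -> exists E, conv p E;
  conv_asymptotic : forall p q c E,
    conv p E -> ray q -> asymptotic c q p -> conv q E;
  conv_same_end : forall p q E, conv p E -> conv q E ->
    exists c, asymptotic c p q;
  conv_inj : forall p E E', conv p E -> conv p E' -> E = E';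
  conv_act : forall g p E, conv p E -> conv (fun t => act g (p t)) (actX g E)
}.

Section Boundary.
Context {R : realType} {T : metricType R} {G : groupType} {X : Type}.
Context (actX : G -> X -> X) (act : G -> T -> T) (conv : (R -> T) -> X -> Prop).
Context (bd : boundary actX act conv).
Implicit Types (E U A B V W : X) (g h k : G) (p q r L K : R -> T) (c a : R).

Let tree : is_tree T := bd_tree bd.
Let isoA := bd_act bd.

Lemma actM g h x : act (g * h)%g x = act g (act h x).
Proof. exact: act_mul. Qed.

Lemma actK g x : act g^-1 (act g x) = x.
Proof. by rewrite -actM mulVg act_one. Qed.

Lemma actKV g x : act g (act g^-1 x) = x.
Proof. by rewrite -actM mulgV act_one. Qed.

Lemma line_act g L : line L -> line (fun t => act g (L t)).
Proof. by move=> lL s t st; rewrite (act_mdist isoA) lL. Qed.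

Lemma asymptotic_act g c p q : asymptotic c p q ->
  asymptotic c (fun t => act g (p t)) (fun t => act g (q t)).
Proof. by move=> [M pq]; exists M => t Mt; rewrite pq. Qed.

Lemma actX1 E : actX 1%g E = E.
Proof.
have [p pE] := conv_ex bd E; have := conv_act bd 1%g pE.
have -> : (fun t => act 1%g (p t)) = p by apply/funext => t; rewrite act_one.
by move=> /(conv_inj bd) /(_ pE).
Qed.

Lemma actXM g h E : actX (g * h)%g E = actX g (actX h E).
Proof.
have [p pE] := conv_ex bd E; have := conv_act bd (g * h)%g pE.
have -> : (fun t => act (g * h)%g (p t)) = (fun t => act g (act h (p t))).
  by apply/funext => t; rewrite actM.
move=> /(conv_inj bd); apply; exact: (conv_act bd g (conv_act bd h pE)).
Qed.

Lemma actXK g E : actX g^-1 (actX g E) = E.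
Proof. by rewrite -actXM mulVg actX1. Qed.

Lemma actXKV g E : actX g (actX g^-1 E) = E.
Proof. by rewrite -actXM mulgV actX1. Qed.

Lemma actXV_fix g E : actX g E = E -> actX g^-1 E = E.
Proof. by move=> H; rewrite -{1}H actXK. Qed.

Lemma asymptotic_same_end p q c E E' :
  conv p E -> conv q E' -> asymptotic c p q -> E = E'.
Proof.
move=> pE qE' pq; apply: (conv_inj bd pE).
exact: (conv_asymptotic bd qE' (conv_ray bd pE) pq).
Qed.

(** ** Translation lengths towards a fixed end *)

(** Near the end [E], which it fixes, [g] moves the points by [c] towards [E]. *)
Definition shift g E c : Prop :=
  exists2 p, conv p E & asymptotic c (fun t => act g (p t)) p.

Lemma shiftP g E c p :
  shift g E c -> conv p E -> asymptotic c (fun t => act g (p t)) p.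
Proof.
move=> [q qE gq] pE; have [d pq] := conv_same_end bd pE qE.
have := asymptotic_trans (asymptotic_trans (asymptotic_act g pq) gq)
  (asymptotic_sym pq).
by have -> : d + c - d = c by lra.
Qed.

Lemma shift_fix g E c : shift g E c -> actX g E = E.
Proof.
by move=> [p pE gp]; apply: (asymptotic_same_end (conv_act bd g pE) pE gp).
Qed.

Lemma shift_ex g E : actX g E = E -> exists c, shift g E c.
Proof.
move=> gE; have [p pE] := conv_ex bd E.
have := conv_act bd g pE; rewrite gE => /(conv_same_end bd) /(_ pE)[c ?].
by exists c, p.
Qed.

Lemma shift_uniq g E c c' : shift g E c -> shift g E c' -> c = c'.
Proof.
move=> [p pE gp] gc'.
exact: asymptotic_uniq (conv_ray bd pE) gp (shiftP gc' pE).
Qed.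

Lemma shiftM g h E c c' :
  shift g E c -> shift h E c' -> shift (g * h)%g E (c + c').
Proof.
move=> gc [p pE hp]; exists p => //; rewrite addrC.
have := asymptotic_trans (asymptotic_act g hp) (shiftP gc pE).
by move=> [M H]; exists M => t /H <-; rewrite actM.
Qed.

Lemma shiftV g E c : shift g E c -> shift g^-1 E (- c).
Proof.
move=> [p pE /(asymptotic_act g^-1) gp]; exists p => //.
apply: asymptotic_sym; case: gp => M H; exists M => t /H <-.
by rewrite actK.
Qed.

Lemma shift1 E : shift 1%g E 0.
Proof.
have [p pE] := conv_ex bd E; exists p => //.
by exists 0 => t _; rewrite addr0 act_one.
Qed.

Lemma shiftX g E c n : shift g E c -> shift (g ^+ n)%g E (n%:R * c).
Proof.
move=> gc; elim: n => [|n IH]; first by rewrite mul0r expg0; exact: shift1.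
by rewrite expgS -natr1 mulrDl mul1r addrC; exact: shiftM.
Qed.

Lemma shiftJ g k E c : shift g E c -> shift (k * g * k^-1)%g (actX k E) c.
Proof.
move=> [p pE gp]; exists (fun t => act k (p t)); first exact: (conv_act bd _ pE).
case: (asymptotic_act k gp) => M H; exists M => t /H <-.
by rewrite !actM actK.
Qed.

(** ** Lines between two ends *)

(** [L] is a parametrization of the line from the end [U] to the end [A]. *)
Definition joins L U A : Prop :=
  [/\ line L, conv (fun t => L (- t)) U & conv L A].

Lemma joins_rev L U A : joins L U A -> joins (fun t => L (- t)) A U.
Proof.
move=> [lL LU LA]; split=> //; first exact: line_rev.
by have -> : (fun t => L (- - t)) = L by apply/funext => t; rewrite opprK.
Qed.

Lemma joins_shift L U A c : joins L U A -> joins (fun t => L (t + c)) U A.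
Proof.
move=> [lL LU LA]; have lLc := line_shift c lL; split=> //.
  apply: (conv_asymptotic bd (c := - c) LU); first exact: (line_ray (line_rev lLc)).
  by exists 0 => t _; congr L; lra.
apply: (conv_asymptotic bd (c := c) LA); first exact/line_ray.
exact: asymptotic_shift.
Qed.

Lemma joins_act g L U A : joins L U A ->
  joins (fun t => act g (L t)) (actX g U) (actX g A).
Proof.
move=> [lL LU LA]; split; first exact: line_act.
  exact: (conv_act bd g LU).
exact: (conv_act bd g LA).
Qed.

Lemma joins_ex U A : U <> A -> exists L, joins L U A.
Proof.
move=> UA; have [p pU] := conv_ex bd U; have [q qA] := conv_ex bd A.
have [|L [lL [c Lp] [c' Lq]]] := rays_line tree (conv_ray bd pU) (conv_ray bd qA).
  by move=> c pq; apply: UA; apply: asymptotic_same_end pU qA pq.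
exists L; split=> //.
  by exact: (conv_asymptotic bd pU (line_ray (line_rev lL)) Lp).
by exact: (conv_asymptotic bd qA (line_ray lL) Lq).
Qed.

Lemma joins_neq L U A : joins L U A -> U <> A.
Proof.
move=> [lL LU LA] UA; rewrite UA in LU.
have [c [M H]] := conv_same_end bd LU LA.
pose t := Num.max (Num.max M 1) (- c).
have : t <= t by []; rewrite {1}/t !ge_max => /andP[/andP[Mt t1] ct].
have := lL (- t) (t + c) ltac:(lra).
by rewrite -H// mdistxx; lra.
Qed.

(** Agreement near one end determines the shift between two parametrizations of
    the same line. *)
Lemma joins_asymptotic L L' U A c : joins L U A -> joins L' U A ->
  asymptotic c L L' -> forall t, L t = L' (t + c).
Proof.
move=> [lL LU LA] [lL' LU' LA'] LL'.
have [c' LL'n] := conv_same_end bd LU LU'.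
exact: line_uniq LL' LL'n.
Qed.

Lemma joins_asymptoticN L L' U A c : joins L U A -> joins L' U A ->
  asymptotic c (fun t => L (- t)) (fun t => L' (- t)) ->
  forall t, L t = L' (t - c).
Proof.
move=> jL jL' LL' t.
have := joins_asymptotic (joins_rev jL) (joins_rev jL') LL' (- t).
by rewrite !opprK => ->; congr L'; lra.
Qed.

Lemma joins_uniq L L' U A : joins L U A -> joins L' U A ->
  exists c, forall t, L t = L' (t + c).
Proof.
move=> jL jL'; have [_ _ LA] := jL; have [_ _ LA'] := jL'.
have [c LL'] := conv_same_end bd LA LA'.
by exists c; exact: joins_asymptotic jL jL' LL'.
Qed.

Lemma joins_shiftE L U A g c :
  joins L U A -> (forall t, act g (L t) = L (t + c)) ->
  shift g A c /\ shift g U (- c).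
Proof.
move=> [lL LU LA] gL; split; first by exists L => //; exists 0.
exists (fun t => L (- t)) => //; exists 0 => t _.
by rewrite gL; congr L; lra.
Qed.

Lemma joins_fix L U A g : joins L U A -> actX g U = U -> actX g A = A ->
  exists c, forall t, act g (L t) = L (t + c).
Proof.
by move=> jL gU gA; have := joins_act g jL; rewrite gU gA => /joins_uniq /(_ jL).
Qed.

Lemma joins_shiftP L U A g c : joins L U A -> actX g U = U -> shift g A c ->
  forall t, act g (L t) = L (t + c).
Proof.
move=> jL gU gA; have [c' H] := joins_fix jL gU (shift_fix gA).
by have [/(shift_uniq gA) -> _] := joins_shiftE jL H.
Qed.

Lemma joins_actX L g c n : (forall t, act g (L t) = L (t + c)) ->
  forall t, act (g ^+ n)%g (L t) = L (t + n%:R * c).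
Proof.
move=> gL; elim: n => [|n IH] t; first by rewrite expg0 act_one// mul0r addr0.
by rewrite expgS actM IH gL -natr1; congr L; lra.
Qed.

Lemma joins_actV L g c : (forall t, act g (L t) = L (t + c)) ->
  forall t, act g^-1 (L t) = L (t - c).
Proof. by move=> gL t; rewrite -{1}(subrK c t) -gL actK. Qed.

Lemma translation_end g P : 0 < mdist P (act g P) ->
  mdist P (act g (act g P)) = 2 * mdist P (act g P) ->
  exists E, shift g E (mdist P (act g P)).
Proof.
move=> l0 l2; have [r [rr r0 gr]] := translation_ray tree (act_mdist isoA g) l0 l2.
by have [E rE] := ray_conv bd rr; exists E, r => //; exists 0.
Qed.

(** An element that moves points towards an end, or away from it, is
    hyperbolic, so it also fixes the other end of its axis. *)
Lemma second_fixed_end g U c : shift g U c -> c != 0 ->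
  exists2 V, V <> U & actX g V = V.
Proof.
wlog c0 : g c / c < 0 => [H gU cn0|gU _].
  case: (ltrgtP c 0) cn0 => // c0 _; first by apply: H gU _ => //; exact/ltr0_neq0.
  have nc0 : - c < 0 by rewrite oppr_lt0.
  have [V VU gV] := H _ _ nc0 (shiftV gU) (ltr0_neq0 nc0).
  by exists V => //; have := actXV_fix gV; rewrite invgK.
have [p pU [M gp]] := gU; have rp := conv_ray bd pU.
pose m := Num.max M 0 - c - c.
have m0 : 0 <= Num.max M 0 by rewrite le_max lexx orbT.
have mM : M <= Num.max M 0 by rewrite le_max lexx.
have g1 : act g (p m) = p (m + c) by apply: gp; rewrite /m; lra.
have g2 : act g (p (m + c)) = p (m + c + c) by apply: gp; rewrite /m; lra.
have d1 : mdist (p m) (p (m + c)) = - c by rewrite metric_sym rp /m; lra.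
have d2 : mdist (p m) (p (m + c + c)) = - c *+ 2 by rewrite metric_sym rp /m; lra.
have [||V gV] := @translation_end g (p m).
- by rewrite g1 d1; lra.
- by rewrite g1 g2 d1 d2; lra.
exists V; last exact: shift_fix gV.
by move=> VU; rewrite VU g1 d1 in gV; have := shift_uniq gV gU; lra.
Qed.

(** ** Projections of ends to lines *)

(** The end [B] projects to the point [L a] of the line [L]. *)
Definition projects L B a : Prop := exists2 r, conv r B & branches_at L r a.

Lemma projects_ex L U A B : joins L U A -> B <> U -> B <> A ->
  exists a, projects L B a.
Proof.
move=> [lL LU LA] BU BA; have [q qB] := conv_ex bd B.
have [||a [r [rr [c rq] br]]] := ray_branch tree lL (conv_ray bd qB).
- by move=> c qL; apply: BA; apply: asymptotic_same_end qB LA qL.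
- by move=> c qL; apply: BU; apply: asymptotic_same_end qB LU qL.
by exists a, r => //; exact: (conv_asymptotic bd qB rr rq).
Qed.

Lemma projects_uniq L B a a' :
  line L -> projects L B a -> projects L B a' -> a = a'.
Proof.
move=> lL [r rB ba] [r' r'B ba']; have [c rr'] := conv_same_end bd rB r'B.
exact: branches_at_uniq lL (conv_ray bd rB) (conv_ray bd r'B) rr' ba ba'.
Qed.

Lemma projects_act g L B a : projects L B a ->
  projects (fun t => act g (L t)) (actX g B) a.
Proof.
move=> [r rB [r0 br]]; exists (fun t => act g (r t)).
  exact: (conv_act bd _ rB).
split=> [|s t s0 t0]; first by rewrite r0.
by rewrite !(act_mdist isoA); exact: br.
Qed.

Lemma projects_shift L B a c :
  projects (fun t => L (t + c)) B a <-> projects L B (a + c).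
Proof.
split=> -[r rB [r0 br]]; exists r => //; split=> // s t s0 t0;
  have [e1 e2] := br s t s0 t0; rewrite -{1}e1 -e2;
  by split; do 2 f_equal; lra.
Qed.

Lemma projects_rev L B a :
  projects L B a -> projects (fun t => L (- t)) B (- a).
Proof.
move=> [r rB [r0 br]]; exists r => //; split; first by rewrite opprK.
move=> s t s0 t0; have [e1 e2] := br s t s0 t0.
by rewrite -{1}e2 -e1; split; do 2 f_equal; lra.
Qed.

(** A hyperbolic element fixes no end but those of its axis. *)
Lemma fixed_ends g L U A B c : joins L U A ->
  (forall t, act g (L t) = L (t + c)) -> c != 0 -> actX g B = B ->
  B = U \/ B = A.
Proof.
move=> jL gL c0 gB; have [?|BU] := pselect (B = U); first by left.
have [?|BA] := pselect (B = A); first by right.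
have [a pa] := projects_ex jL BU BA.
have := projects_act g pa; rewrite gB.
have -> : (fun t => act g (L t)) = (fun t => L (t + c)) by apply/funext.
move=> /projects_shift pac; have [lL _ _] := jL.
have ac := projects_uniq lL pa pac.
by move/eqP: c0; case; lra.
Qed.

(** The line from [U] to [B] that follows [L] up to its branching point. *)
Lemma joins_branch L r U A B a : joins L U A -> conv r B ->
  branches_at L r a ->
  joins (fun t => if t <= 0 then L (a + t) else r t) U B.
Proof.
move=> [lL LU LA] rB [r0 br]; have rr := conv_ray bd rB.
have lK : line (fun t => if t <= 0 then L (a + t) else r t).
  have -> : (fun t => if t <= 0 then L (a + t) else r t) =
            (fun t => if t <= 0 then L (a - (- t)) else r t).
    by apply/funext => t; rewrite opprK.
  apply: (@line_of_rays _ _ (fun t => L (a - t)) r) => //.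
    by move=> s t s0 st; rewrite metric_sym lL; lra.
  by move=> s t s0 t0; rewrite metric_sym (br t s t0 s0).2 addrC.
split=> //.
  apply: (conv_asymptotic bd (c := - a) LU); first exact: (line_ray (line_rev lK)).
  exists 0 => t t0; rewrite ifT; last lra.
  by congr L; lra.
apply: (conv_asymptotic bd (c := 0) rB); first exact/line_ray.
exists 1 => t t1; rewrite ifF ?addr0//; apply/negbTE.
by rewrite -ltNge; lra.
Qed.

Lemma projects_branch L r U A B a : joins L U A -> conv r B ->
  branches_at L r a ->
  projects (fun t => if t <= 0 then L (a + t) else r t) A 0.
Proof.
move=> [lL LU LA] rB [r0 br]; have rr := conv_ray bd rB.
exists (fun t => L (t + a)).
  apply: (conv_asymptotic bd (c := a) LA); first exact: (line_ray (line_shift a lL)).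
  exact: asymptotic_shift.
split=> [|s t s0 t0]; first by rewrite lexx addrC.
rewrite add0r; split; last first.
  rewrite sub0r ifT; last lra.
  by rewrite metric_sym lL; lra.
case: (lerP t 0) => t1; last by rewrite metric_sym (addrC s) (br t s t0 s0).1 addrC.
by have -> : t = 0; [lra|rewrite addr0 metric_sym lL; lra].
Qed.

(** If [al], [be] and [ga] fix the ends [U], [B] and [A] respectively and move
    the line from [U] to [A] first to the line from [U] to [B], then to the
    line from [A] to [B], and then back to the line from [A] to [U], their
    product reflects this line. The reflection point determines the projection
    of [B], because every step follows a common ray of two lines. *)
Lemma reflection L U A B a al be ga su sb sa : joins L U A -> projects L B a ->
  actX al A = B -> actX be U = A -> actX ga B = U ->
  shift al U su -> shift be B sb -> shift ga A sa ->
  forall t, act (ga * be * al)%g (L t) = L (2 * a + sa + su - sb - t).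
Proof.
move=> jL [r rB br] alA beU gaB alU beB gaA t; have [r0 br'] := br.
have jLr := joins_rev jL.
have brr : branches_at (fun t => L (- t)) r (- a).
  split; first by rewrite opprK.
  move=> s u s0 u0; have [e1 e2] := br' s u s0 u0.
  by rewrite -{1}e2 -e1; split; do 2 f_equal; lra.
have jM := joins_branch jL rB br; have jN := joins_branch jLr rB brr.
set M := (fun t => if _ then _ else _) in jM.
set N := (fun t => if _ then _ else _) in jN.
have MnE u : 0 <= u -> M (- u) = L (a - u) by move=> ?; rewrite /M ifT//; lra.
have NnE u : 0 <= u -> N (- u) = L (a + u).
  by move=> ?; rewrite /N ifT; [congr L; lra|lra].
have MNE u : 0 < u -> M u = N u by move=> u0; rewrite /M /N leNgt u0.
have s1 u : act al (L u) = M (u - a - su).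
  have jK : joins (fun t => L (t + a)) U A by exact: joins_shift.
  have := joins_act al jK; rewrite (shift_fix alU) alA => jK'.
  rewrite -(subrK a u); have [_ KU _] := jK.
  rewrite (joins_asymptoticN jK' jM (c := su)); first by congr M; lra.
  rewrite -(addr0 su); apply: asymptotic_trans (shiftP alU KU) _.
  by exists 0 => v v0; rewrite addr0 MnE//; congr L; lra.
have s2 u : act be (M u) = N (u + sb).
  have := joins_act be jM; rewrite (shift_fix beB) beU => jM'.
  have [_ _ MB] := jM.
  apply: (joins_asymptotic jM' jN (c := sb)).
  rewrite -(addr0 sb); apply: asymptotic_trans (shiftP beB MB) _.
  by exists 1 => v v1; rewrite addr0 MNE//; lra.
have s3 u : act ga (N u) = L (a - (u - sa)).
  have jK : joins (fun t => L (- t + a)) A U.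
    by apply: (joins_rev (joins_shift a jL)).
  have := joins_act ga jN; rewrite (shift_fix gaA) gaB => jN'.
  have [_ NA _] := jN.
  rewrite (joins_asymptoticN jN' jK (c := sa)); first by congr L; lra.
  rewrite -(addr0 sa); apply: asymptotic_trans (shiftP gaA NA) _.
  by exists 0 => v v0; rewrite addr0 NnE//; congr L; lra.
by rewrite !actM s1 s2 s3; congr L; lra.
Qed.

End Boundary.

(** * Derangements *)

(** Jordan's theorem: the average number of fixed points in a transitive group
    is one, but the identity has more. *)
Lemma transitive_derangement (I : finType) (P : {group {perm I}}) :
  (1 < #|I|)%N -> (forall i j, exists2 p, p \in P & p i = j) ->
  exists2 p, p \in P & forall i, p i <> i.
Proof.
move=> I1 tr; apply: contrapT => H.
have i0 : I by move: I1; case: (pickP (@predT I)) => // /eq_card0 ->.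
have orb : [set orbit 'P P x | x in [set: I]]%SET = [set [set: I]%SET]%SET.
  apply/setP => S; rewrite inE; apply/imsetP/eqP => [[x _ ->]|->].
    apply/setP => y; rewrite inE; apply/orbitP.
    by have [p pP <-] := tr x y; exists p.
  exists i0 => //; apply/setP => y; rewrite inE; apply/esym/orbitP.
  by have [p pP <-] := tr i0 y; exists p.
have actsP : [acts P, on [set: I]%SET | 'P]%g.
  apply/fintype.subsetP => p _; rewrite !inE.
  by apply/fintype.subsetP => x _; rewrite !inE.
have := Frobenius_Cauchy actsP; rewrite orb cards1 mul1n => E.
have : (\sum_(a in P) 1 < \sum_(a in P) #|('Fix_([set: I]%SET | 'P)[a])%g|)%N.
  have fix_ge1 p : p \in P -> (1 <= #|('Fix_([set: I]%SET | 'P)[p])%g|)%N.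
    move=> pP; rewrite card_gt0; apply/set0Pn; apply: contrapT => nfix.
    apply: H; exists p => // i pi; apply: nfix; exists i.
    by apply/finset.setIP; split; [rewrite inE|exact/afix1P].
  rewrite (bigD1 1%g) ?group1//= [X in (_ < X)%N](bigD1 1%g) ?group1//=.
  have -> : #|('Fix_([set: I]%SET | 'P)[1])%g| = #|I|.
    rewrite -cardsT; apply: eq_card => i; rewrite [RHS]inE.
    by apply/finset.setIP; split; [rewrite inE|apply/afix1P; rewrite act1].
  by rewrite -addSn leq_add// leq_sum// => p /andP[pP _]; exact: fix_ge1.
by rewrite E sum1_card ltnn.
Qed.

Lemma frequent_value (I : finType) (u : nat -> I) :
  exists v, forall M, exists2 n, (M <= n)%N & u n = v.
Proof.
apply: contrapT => H.
have /choice[M MP] v : exists M, forall n, (M <= n)%N -> u n <> v.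
  apply: contrapT => nv; apply: H; exists v => M; apply: contrapT => nM.
  by apply: nv; exists M => n Mn un; apply: nM; exists n.
pose N := (\max_v M v)%N.
by apply: (MP (u N) N) => //; exact: leq_bigmax.
Qed.

(** * Directions at a point *)

Section Directions.
Context {R : realType} {T : metricType R} {G : groupType} {X : Type}.
Context (actX : G -> X -> X) (act : G -> T -> T) (conv : (R -> T) -> X -> Prop).
Context (bd : boundary actX act conv).
Implicit Types (E U A B V W : X) (g h k s : G) (x : T) (p q r L : R -> T).
Implicit Types (a c : R).

Let tree : is_tree T := bd_tree bd.
Let isoA := bd_act bd.

(** The rays from [x] to the ends [E] and [E'] locally coincide. *)
Definition same_direction x E E' : Prop := exists p q e,
  [/\ conv p E, conv q E', p 0 = x, q 0 = x & 0 < e /\ p e = q e].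

(** The directions at [x], viewed as classes of ends, are numbered by [D]. *)
Definition directions_numbered x N (D : X -> 'I_N) : Prop :=
  (forall i, exists E, D E = i) /\
  forall E E', D E = D E' <-> same_direction x E E'.

Definition finite_directions x : Prop :=
  exists N (D : X -> 'I_N), directions_numbered x D.

Lemma ray_uniq p q E : conv p E -> conv q E -> p 0 = q 0 ->
  forall t, 0 <= t -> p t = q t.
Proof.
move=> pE qE pq0; have rp := conv_ray bd pE; have rq := conv_ray bd qE.
have [c [M pq]] := conv_same_end bd pE qE.
have [//|[m [m0 _ dpq]]] := fork_rays tree rp rq pq0.
pose t := Num.max (Num.max M (m + 1)) (Num.max 0 (- c)).
have : t <= t by [].
rewrite {1}/t !ge_max => /andP[/andP[Mt mt] /andP[t0 ct]].
have E1 := pq t Mt; have d1 := rp 0 t (lexx 0) t0.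
have d2 := rq 0 (t + c) (lexx 0) ltac:(lra).
rewrite -pq0 -E1 in d2; have c0 : c = 0 by lra.
have := dpq t t ltac:(lra) ltac:(lra).
by rewrite E1 c0 addr0 mdistxx; lra.
Qed.

Lemma ray_at x E : exists2 p, conv p E & p 0 = x.
Proof.
have [p pE] := conv_ex bd E.
have [q [c [rq q0 qp]]] := ray_from tree (conv_ray bd pE) x.
by exists q => //; exact: (conv_asymptotic bd pE rq qp).
Qed.

Lemma same_direction_act g x E E' : act g x = x -> same_direction x E E' ->
  same_direction x (actX g E) (actX g E').
Proof.
move=> gx [p [q [e [pE qE' p0 q0 [e0 pqe]]]]].
exists (fun t => act g (p t)), (fun t => act g (q t)), e.
by split; rewrite ?p0 ?q0 ?pqe//; apply: (conv_act bd).
Qed.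

Lemma not_same_direction x E E' : ~ same_direction x E E' ->
  exists2 L, joins conv L E E' & L 0 = x.
Proof.
move=> nEE'; have [p pE p0] := ray_at x E; have [q qE' q0] := ray_at x E'.
have rp := conv_ray bd pE; have rq := conv_ray bd qE'.
have agree0 e : 0 < e -> p e = q e -> False.
  by move=> e0 pqe; apply: nEE'; exists p, q, e.
have [H|[m [m0 H dpq]]] := fork_rays tree rp rq (etrans p0 (esym q0)).
  by case: (agree0 1 ltr01); apply: H.
have {}m0 : m = 0.
  apply/eqP; rewrite eq_le m0 andbT leNgt; apply/negP => mp.
  by apply: (agree0 m mp); apply: H => //; exact: ltW.
exists (fun t => if t <= 0 then p (- t) else q t); last first.
  by rewrite lexx oppr0.
have lL : line (fun t => if t <= 0 then p (- t) else q t).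
  by apply: line_of_rays => // s t s0 t0; rewrite dpq; lra.
split=> //.
  apply: (conv_asymptotic bd (c := 0) pE); first exact: (line_ray (line_rev lL)).
  by exists 0 => t t0; rewrite ifT ?opprK ?addr0//; lra.
apply: (conv_asymptotic bd (c := 0) qE'); first exact: line_ray.
by exists 1 => t t1; rewrite ifF ?addr0//; apply/negbTE; rewrite -ltNge; lra.
Qed.

Lemma joins_not_same_direction L U A a : joins conv L U A ->
  ~ same_direction (L a) U A.
Proof.
move=> jL [p [q [e [pU qA p0 q0 [e0 pqe]]]]].
have [lK KU KA] := joins_shift bd a jL.
have E1 := ray_uniq pU KU; rewrite oppr0 add0r in E1.
have E2 := ray_uniq qA KA; rewrite add0r in E2.
have [lL _ _] := jL; have := lL (- e + a) (e + a) ltac:(lra).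
by rewrite -(E1 p0)// -?(E2 q0) ?pqe ?mdistxx; lra.
Qed.

Lemma projects_not_same_direction L U A B a : joins conv L U A ->
  projects conv L B a ->
  ~ same_direction (L a) U B /\ ~ same_direction (L a) A B.
Proof.
move=> jL pB; split.
  have [r rB br] := pB.
  have := joins_not_same_direction (a := 0) (joins_branch bd jL rB br).
  by rewrite lexx addr0.
have [r rB br] := projects_rev pB.
have := joins_not_same_direction (a := 0) (joins_branch bd (joins_rev jL) rB br).
by rewrite lexx addr0 opprK.
Qed.

Lemma direction_perm x N (D : X -> 'I_N) g : directions_numbered x D ->
  act g x = x -> exists p : {perm 'I_N}, forall E, D (actX g E) = p (D E).
Proof.
move=> [/choice[e eP] DP] gx.
have gDP E E' : D E = D E' -> D (actX g E) = D (actX g E').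
  by move=> /DP H; apply/DP; exact: same_direction_act.
have gVx : act g^-1 x = x by rewrite -{1}gx (actK bd).
have inj : injective (fun i => D (actX g (e i))).
  move=> i j /DP /(same_direction_act gVx).
  by rewrite !(actXK bd) => /DP; rewrite !eP.
by exists (perm inj) => E; rewrite permE; apply: gDP; rewrite eP.
Qed.

(** ** Two-transitivity *)

Context (two_trans : forall U A U' A', U <> A -> U' <> A' ->
  exists g, actX g U = U' /\ actX g A = A').

(** The horospheric stabilizer of [V] is transitive on the other ends: a
    translation towards [V] can be compensated along the axis to [E']. *)
Lemma horospheric_transitive V E E' : E <> V -> E' <> V ->
  exists g, [/\ actX g E = E' & shift act conv g V 0].
Proof.
move=> EV E'V.
have [g [gV gE]] := two_trans (fun H => EV (esym H)) (fun H => E'V (esym H)).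
have [c gc] := shift_ex bd gV.
have [c0|c0] := eqVneq c 0; first by exists g; rewrite -{1}c0.
have [W WV gW] := second_fixed_end bd gc c0.
have [k [kV kW]] := two_trans (fun H => WV (esym H)) (fun H => E'V (esym H)).
exists ((k * g * k^-1)^-1 * g)%g; split.
  rewrite (actXM bd) gE; apply: (actXV_fix bd).
  by rewrite !(actXM bd) -{1}kW (actXK bd) gW.
have := shiftJ bd k gc; rewrite kV => /(shiftV bd) gc'.
by have := shiftM bd gc' gc; rewrite addNr.
Qed.

(** By Jordan's theorem, the stabilizer of a branch point of finite valency
    contains an element fixing no direction at this point. *)
Lemma direction_derangement x N (D : X -> 'I_N) U A B :
  directions_numbered x D -> ~ same_direction x U A ->
  ~ same_direction x U B -> ~ same_direction x A B ->
  exists g, act g x = x /\ exists p : {perm 'I_N},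
    (forall E, D (actX g E) = p (D E)) /\ forall i, p i <> i.
Proof.
move=> DN UA UB AB; have [Dsurj DP] := DN.
pose Q (p : {perm 'I_N}) :=
  exists g, act g x = x /\ forall E, D (actX g E) = p (D E).
pose P := [set p | `[< Q p >]]%SET.
have gP : group_set P.
  apply/group_setP; split=> [|p q].
    rewrite inE; apply/asboolP; exists 1%g; split; first exact: act_one.
    by move=> E; rewrite (actX1 bd) perm1.
  rewrite !inE => -[g [gx gp]] [h [hx hq]].
  exists (h * g)%g; rewrite (actM bd) gx hx; split=> // E.
  by rewrite (actXM bd) hq gp permM.
have DUA : D U <> D A by move=> /DP.
have DUB : D U <> D B by move=> /DP.
have DAB : D A <> D B by move=> /DP.
have N1 : (1 < #|'I_N|)%N.
  rewrite ltnNge; apply/negP => /card_le1_eqP H.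
  by apply: DUA; apply: H.
have tr i j : exists2 p, p \in Group gP & p i = j.
  have [E DE] := Dsurj i; have [E' DE'] := Dsurj j.
  have [V [VE VE']] : exists V, D V <> D E /\ D V <> D E'.
    rewrite DE DE'; have [Ui|Ui] := eqVneq (D U) i.
      have [Aj|Aj] := eqVneq (D A) j.
        by exists B; rewrite -Ui -Aj; split=> H; [apply: DUB|apply: DAB].
      by exists A; rewrite -Ui; split; [exact: nesym|exact/eqP].
    have [Uj|Uj] := eqVneq (D U) j; last by exists U; split; exact/eqP.
    have [Ai|Ai] := eqVneq (D A) i.
      by exists B; rewrite -Uj -Ai; split=> H; [apply: DAB|apply: DUB].
    by exists A; rewrite -Uj; split; [exact/eqP|exact: nesym].
  have neq F : D V <> D F -> F <> V by move=> VF FV; apply: VF; rewrite FV.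
  have [g [gE gV]] := horospheric_transitive (neq _ VE) (neq _ VE').
  have [L1 j1 L10] := not_same_direction (fun H => VE (iffRL (DP _ _) H)).
  have [L2 j2 L20] := not_same_direction (fun H => VE' (iffRL (DP _ _) H)).
  have gx : act g x = x.
    have := joins_act bd g j1; rewrite (shift_fix bd gV) gE => j1'.
    have [_ L1V _] := j1; have [_ L2V _] := j2.
    rewrite -{1}L10 (joins_asymptoticN bd j1' j2 (c := 0)) ?subr0//.
    rewrite -(addr0 0); apply: asymptotic_trans (shiftP bd gV L1V) _.
    exists 0 => t t0; rewrite addr0.
    by apply: (ray_uniq L1V L2V) => //; rewrite oppr0 L10 L20.
  have [p pP] := direction_perm DN gx.
  exists p; first by rewrite inE; apply/asboolP; exists g.
  by rewrite -DE -DE' -gE pP.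
have [p] := transitive_derangement N1 tr.
by rewrite inE => /asboolP[g [gx gp]] pD; exists g; split=> //; exists p.
Qed.

(** ** Conjugates of a horospheric element *)

(** The conjugate of [s] by [h ^+ n]. *)
Definition conj_pow h s n : G := (h ^+ n * s * h ^- n)%g.

Lemma act_conj_pow L h s c n t : (forall t, act h (L t) = L (t + c)) ->
  act (conj_pow h s n) (L t) = act (h ^+ n)%g (act s (L (t - n%:R * c))).
Proof.
move=> hL; have hnL := joins_actX bd n hL.
by rewrite /conj_pow !(actM bd) (joins_actV bd hnL).
Qed.

(** If [h] pushes away from [A], its conjugates of [s] eventually fix any given
    point of the line. Two of them that act alike on the finitely many
    directions there cancel, so that a derangement of these directions can be
    corrected to keep its effect. *)
Lemma no_fixed_end L U A B h s c :
  (forall x, finite_directions x) ->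
  joins conv L U A -> B <> U -> B <> A ->
  (forall t, act h (L t) = L (t + c)) -> c < 0 -> shift act conv s A 0 ->
  exists g m, (forall E, actX g E <> E) /\
    forall N, exists2 n, (N <= n)%N & forall E,
      actX (g * (conj_pow h s m)^-1 * conj_pow h s n)%g E <> E.
Proof.
move=> fin jL BU BA hL c0 sA; have [a pB] := projects_ex bd jL BU BA.
set x := L a; have [N [D DN]] := fin x.
have [UB AB] := projects_not_same_direction jL pB.
have [g [gx [pg [gpg pgD]]]] :=
  direction_derangement DN (joins_not_same_direction jL) UB AB.
have [_ _ LA] := jL; have [M sL] := shiftP bd sA LA.
have [N0 N0P] : exists N0, forall n, (N0 <= n)%N -> M <= a - n%:R * c.
  exists (Num.truncn `|(M - a) / - c|).+1 => n Nn.
  have nc : 0 < - c by rewrite oppr_gt0.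
  have : (M - a) / - c <= n%:R.
    rewrite (le_trans (ler_norm _))// (le_trans (ltW (truncnS_gt _)))//.
    by rewrite ler_nat.
  by rewrite ler_pdivrMr//; lra.
have kx n : (N0 <= n)%N -> act (conj_pow h s n) x = x.
  move=> /N0P Mn; rewrite (act_conj_pow s n a hL) sL// addr0.
  by rewrite (joins_actX bd n hL) subrK.
have /choice[u uP] n : exists p : {perm 'I_N}, (N0 <= n)%N ->
    forall E, D (actX (conj_pow h s n) E) = p (D E).
  case: (leqP N0 n) => Nn; last by exists 1%g.
  by have [p pP] := direction_perm DN (kx n Nn); exists p.
have [v vP] := frequent_value u.
have [m N0m um] := vP N0.
exists g, m; split=> [E gE|N1]; first by apply: (pgD (D E)); rewrite -gpg gE.
have [n Nn un] := vP (maxn N0 N1); rewrite geq_max in Nn.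
case/andP: Nn => N0n N1n; exists n => // E gE.
apply: (pgD (D E)); rewrite -[RHS](congr1 D gE) 2!(actXM bd) gpg; congr (pg _).
apply: (@perm_inj _ v); rewrite -{2}um -(uP m N0m) -un -(uP n N0n).
by rewrite (actXKV bd).
Qed.

(** If [h] pushes towards [A], the product of [g] and a high conjugate of [s]
    is hyperbolic. Indeed the conjugate fixes a point [P] of the line far out
    towards [A] but no point of the line before [P], whereas [g] moves the far
    parts of the line away from it; hence the segments from [P] to its
    image and to its preimage leave [P] in different directions. *)
Lemma fixed_end L U A h s g c :
  joins conv L U A -> (forall t, act h (L t) = L (t + c)) -> 0 < c ->
  shift act conv s A 0 -> actX s U <> U -> actX g A <> A ->
  exists N, forall n, (N <= n)%N ->
    exists E, actX (g * conj_pow h s n)%g E = E.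
Proof.
move=> jL hL c0 sA sU gA; have [lL LU LA] := jL.
have sLA : asymptotic 0 L (fun t => act s (L t)).
  by rewrite -oppr0; exact: asymptotic_sym (shiftP bd sA LA).
have [|a [La dL]] := lines_split tree lL (line_act bd s lL) sLA.
  move=> b sLU; apply: sU; apply: esym.
  exact: (asymptotic_same_end bd LU (conv_act bd s LU) sLU).
have [|C [M dM]] :=
    rays_diverge tree (line_ray lL) (line_ray (line_act bd g lL)).
  move=> b gLA; apply: gA; apply: esym.
  exact: (asymptotic_same_end bd LA (conv_act bd g LA) gLA).
have [N NP] : exists N, forall n, (N <= n)%N -> M <= a + n%:R * c - 1.
  exists (Num.truncn `|(M - a + 1) / c|).+1 => n Nn.
  have : (M - a + 1) / c <= n%:R.
    rewrite (le_trans (ler_norm _))// (le_trans (ltW (truncnS_gt _)))//.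
    by rewrite ler_nat.
  by rewrite ler_pdivrMr//; lra.
exists N => n /NP Mn.
set k := conj_pow h s n; pose S := a + n%:R * c; rewrite -/S in Mn.
pose P := L S; pose Q := L (S - 1).
have kL t : act k (L t) = act (h ^+ n)%g (act s (L (t - n%:R * c))).
  exact: act_conj_pow.
have kP : act k P = P.
  have -> : P = act (h ^+ n)%g (L a) by rewrite (joins_actX bd n hL).
  rewrite {1}(joins_actX bd n hL) kL -La; last lra.
  by rewrite addrK.
have kQ : mdist (act k Q) Q = 2.
  have -> : Q = act (h ^+ n)%g (L (a - 1)).
    by rewrite (joins_actX bd n hL) /Q /S; congr L; lra.
  rewrite {1}(joins_actX bd n hL) kL (act_mdist isoA) metric_sym.
  by rewrite addrK dL; lra.
have dPQ : mdist Q P = 1 by rewrite lL; lra.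
have dPgP : mdist P (act g P) = S + S + C by rewrite dM; lra.
have dQgP : mdist Q (act g P) = S - 1 + S + C by rewrite dM; lra.
have dPgQ : mdist P (act g Q) = S + (S - 1) + C by rewrite dM; lra.
pose f := (g * k)%g; pose P' := act f^-1 P; pose Q' := act k^-1 Q.
have fP' : act f P' = P by rewrite (actKV bd).
have fP : act f P = act g P by rewrite (actM bd) kP.
have kQ' : act k Q' = Q by rewrite (actKV bd).
have e1 : mdist P' P = S + S + C by rewrite -(act_mdist isoA f) fP' fP.
have e2 : mdist Q' Q = 2 by rewrite -(act_mdist isoA k) kQ' metric_sym.
have e3 : mdist Q' P = 1 by rewrite -(act_mdist isoA k) kQ' kP.
have e4 : mdist Q' P' = S + (S - 1) + C.
  by rewrite -(act_mdist isoA f) fP' (actM bd) kQ' metric_sym.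
have dQgP0 := mdist_ge0 Q (act g P).
have tr := metric_triangle P' P (act g P).
have f1 := four_point tree Q' Q P (act g P).
have f2 := four_point tree Q' (act g P) P P'.
rewrite (metric_sym P P') (metric_sym (act g P) P') (metric_sym (act g P) P) in f2.
have d2 : mdist P' (act g P) = 2 * (S + S + C) by case: f1 f2 => [?|?] [?|?]; lra.
have [||E fE] := @translation_end _ _ _ _ _ _ _ bd f P'.
- by rewrite fP'; lra.
- by rewrite fP' fP d2 e1.
by exists E; exact: shift_fix fE.
Qed.

End Directions.

(** * Two trees with the same ends *)

(** A subgroup of the plane, not contained in an axis, that misses the open
    fourth quadrant lies on a line of positive slope. *)
Lemma positively_proportional (R : realType) (S : R -> R -> Prop) :
  (forall a b a' b', S a b -> S a' b' -> S (a + a') (b + b')) ->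
  (forall a b, S a b -> S (- a) (- b)) ->
  (forall a b, S a b -> 0 < a -> b < 0 -> False) ->
  (exists a b, S a b /\ a != 0) -> (exists a b, S a b /\ b != 0) ->
  exists2 l, 0 < l & forall a b, S a b -> b = l * a.
Proof.
move=> SD SN Sneg [x [y [Sxy x0]]] [x' [y' [Sxy' y'0]]].
wlog {x0} x0 : x y Sxy / 0 < x.
  move=> H; case: (ltrgtP x 0) x0 => // x1 _; last exact: H Sxy x1.
  by apply: (H _ _ (SN _ _ Sxy)); rewrite oppr_gt0.
wlog {y'0} y'0 : x' y' Sxy' / y' < 0.
  move=> H; case: (ltrgtP y' 0) y'0 => // y1 _; first exact: H Sxy' y1.
  by apply: (H _ _ (SN _ _ Sxy')); rewrite oppr_lt0.
have Sn n a b : S a b -> S (n%:R * a) (n%:R * b).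
  move=> Sab; elim: n => [|n IH]; last first.
    by rewrite -natr1 !mulrDl !mul1r; exact: SD.
  by rewrite !mul0r; have := SD _ _ _ _ Sab (SN _ _ Sab); rewrite !subrr.
have Sz (z : int) a b : S a b -> S (z%:~R * a) (z%:~R * b).
  move=> Sab; case: z => n; first exact: Sn.
  by rewrite NegzE !mulrNz !mulNr; apply/SN/Sn.
have y0 : 0 < y.
  case: (ltrgtP y 0) => // [y1|y1]; first by case: (Sneg _ _ Sxy x0 y1).
  pose n := (Num.truncn (`|x'| / x)).+1.
  have := SD _ _ _ _ (Sn n _ _ Sxy) Sxy'; rewrite y1 mulr0 add0r => Sxn.
  case: (Sneg _ _ Sxn _ y'0).
  have : `|x'| < n%:R * x by rewrite -ltr_pdivrMr// truncnS_gt.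
  by have := lerNnormlW (lexx `|x'|); lra.
have lt_absurd a b : S a b -> b < y / x * a -> False.
  move=> Sab bl.
  (* For a rational [q] strictly between [b / y] and [a / x], a multiple of
     [(a, b) - q (x, y)] is an element of [S] in the fourth quadrant. *)
  have : b / y < a / x.
    by rewrite ltr_pdivrMr//; have -> : a / x * y = y / x * a by ring.
  move=> /rat_in_itvoo[q]; rewrite in_itv /= /ratr => /andP[bq qa].
  have d0 : 0 < (denq q)%:~R :> R by rewrite ltr0z denq_gt0.
  rewrite ltr_pdivlMr// mulrAC ltr_pdivrMr// in bq.
  rewrite ltr_pdivrMr// mulrAC ltr_pdivlMr// in qa.
  have := SD _ _ _ _ (Sz (denq q) _ _ Sab) (SN _ _ (Sz (numq q) _ _ Sxy)).
  by move=> /Sneg; apply; lra.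
exists (y / x); first exact: divr_gt0.
move=> a b Sab; apply/eqP; rewrite eq_le !leNgt; apply/andP; split; apply/negP.
  move=> lb; apply: (lt_absurd _ _ (SN _ _ Sab)); lra.
by move=> bl; exact: lt_absurd Sab bl.
Qed.

Section Opposite.
Context {R : realType} {T1 T2 : metricType R} {G : groupType} {X : Type}.
Context (actX : G -> X -> X) (act1 : G -> T1 -> T1) (act2 : G -> T2 -> T2).
Context (conv1 : (R -> T1) -> X -> Prop) (conv2 : (R -> T2) -> X -> Prop).
Context (bd1 : boundary actX act1 conv1) (bd2 : boundary actX act2 conv2).
Context (two_trans : forall U A U' A', U <> A -> U' <> A' ->
  exists g, actX g U = U' /\ actX g A = A').
Context (third : forall U A : X, exists B, B <> U /\ B <> A).
Implicit Types (E U A B V W : X) (g h k s : G).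

(** With [B] a third end and [k] mapping the pair [(A, U)] to [(A, B)], the
    commutator of [k] and [h] fixes [A] without moving points towards it, but
    moves [U]. Far conjugates of it are nearly trivial on the second tree, but
    not on the first one. *)
Lemma opposite_shifts_absurd h U A c1 c2 : (forall x, finite_directions conv2 x) ->
  U <> A -> actX h U = U -> shift act1 conv1 h A c1 -> shift act2 conv2 h A c2 ->
  0 < c1 -> c2 < 0 -> False.
Proof.
move=> fin2 UA hU h1 h2 c10 c20; have hA := shift_fix bd1 h1.
have [L1 j1] := joins_ex bd1 UA; have [L2 j2] := joins_ex bd2 UA.
have hL1 := joins_shiftP bd1 j1 hU h1; have hL2 := joins_shiftP bd2 j2 hU h2.
have [B [BU BA]] := third U A.
have [k [kA kU]] := two_trans (nesym UA) (nesym BA).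
pose s := (k * h * k^-1 * h^-1)%g.
have s1 : shift act1 conv1 s A 0.
  have := shiftJ bd1 k h1; rewrite kA => kh1.
  by have := shiftM bd1 kh1 (shiftV bd1 h1); rewrite subrr.
have s2 : shift act2 conv2 s A 0.
  have := shiftJ bd2 k h2; rewrite kA => kh2.
  by have := shiftM bd2 kh2 (shiftV bd2 h2); rewrite subrr.
have sU : actX s U <> U.
  rewrite /s !(actXM bd1) (actXV_fix bd1 hU) => sU.
  have hkU : actX h (actX k^-1 U) = actX k^-1 U by rewrite -{2}sU (actXK bd1).
  have [kU'|kA'] := fixed_ends bd1 j1 hL1 (lt0r_neq0 c10) hkU.
    by apply: BU; rewrite -kU -{1}kU' (actXKV bd1).
  by apply: UA; rewrite -kA -kA' (actXKV bd1).
have [g [m [gE gmE]]] := no_fixed_end bd2 two_trans fin2 j2 BU BA hL2 c20 s2.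
pose g' := (g * (conj_pow h s m)^-1)%g.
have sA := shift_fix bd1 s1.
have hmA : actX (h ^+ m)%g A = A by exact: shift_fix (shiftX bd1 m h1).
have kmA : actX (conj_pow h s m) A = A.
  by rewrite /conj_pow 2!(actXM bd1) (actXV_fix bd1 hmA) sA.
have g'A : actX g' A <> A.
  by rewrite /g' (actXM bd1) (actXV_fix bd1 kmA).
have [N NP] := fixed_end bd1 j1 hL1 c10 s1 sU g'A.
have [n Nn nE] := gmE N; have [E] := NP n Nn.
exact: nE.
Qed.

(** ** Projections determine each other *)

(** The products of the reflections determined by [B] and [B'] translate the
    line in both trees. *)
Lemma projections_proportional l L1 L2 U A B B' a1 a2 a1' a2' :
  (forall g E c1 c2, shift act1 conv1 g E c1 -> shift act2 conv2 g E c2 ->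
    c2 = l * c1) ->
  joins conv1 L1 U A -> joins conv2 L2 U A ->
  B <> U -> B <> A -> B' <> U -> B' <> A ->
  projects conv1 L1 B a1 -> projects conv2 L2 B a2 ->
  projects conv1 L1 B' a1' -> projects conv2 L2 B' a2' ->
  a2' - a2 = l * (a1' - a1).
Proof.
move=> prop j1 j2 BU BA BU' BA' p1 p2 p1' p2'; have UA := joins_neq bd1 j1.
have refl F b1 b2 : F <> U -> F <> A -> projects conv1 L1 F b1 ->
    projects conv2 L2 F b2 -> exists g r1, [/\ actX g U = A, actX g A = U,
      forall t, act1 g (L1 t) = L1 (2 * b1 + r1 - t)
      & forall t, act2 g (L2 t) = L2 (2 * b2 + l * r1 - t)].
  move=> FU FA q1 q2.
  have [al [alU alA]] := two_trans UA (nesym FU).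
  have [be [beU beF]] := two_trans (nesym FU) (nesym FA).
  have [ga [gaA gaF]] := two_trans (nesym FA) (nesym UA).
  have [su1 al1] := shift_ex bd1 alU; have [su2 al2] := shift_ex bd2 alU.
  have [sb1 be1] := shift_ex bd1 beF; have [sb2 be2] := shift_ex bd2 beF.
  have [sa1 ga1] := shift_ex bd1 gaA; have [sa2 ga2] := shift_ex bd2 gaA.
  exists (ga * be * al)%g, (sa1 + su1 - sb1); split.
  - by rewrite !(actXM bd1) alU beU gaA.
  - by rewrite !(actXM bd1) alA beF gaF.
  - move=> t; rewrite (reflection bd1 j1 q1 alA beU gaF al1 be1 ga1).
    by congr L1; lra.
  - move=> t; rewrite (reflection bd2 j2 q2 alA beU gaF al2 be2 ga2).
    rewrite (prop _ _ _ _ al1 al2) (prop _ _ _ _ be1 be2) (prop _ _ _ _ ga1 ga2).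
    by congr L2; ring.
have [g [r [gU gA g1 g2]]] := refl B _ _ BU BA p1 p2.
have [g' [r' [gU' gA' g1' g2']]] := refl B' _ _ BU' BA' p1' p2'.
have s1 t : act1 (g' * g)%g (L1 t) = L1 (t + (2 * (a1' - a1) + r' - r)).
  by rewrite (actM bd1) g1 g1'; congr L1; ring.
have s2 t : act2 (g' * g)%g (L2 t) = L2 (t + (2 * (a2' - a2) + l * r' - l * r)).
  by rewrite (actM bd2) g2 g2'; congr L2; ring.
have [s1A _] := joins_shiftE j1 s1; have [s2A _] := joins_shiftE j2 s2.
by have := prop _ _ _ _ s1A s2A; lra.
Qed.

End Opposite.

(** * Trees without translations *)

Section Star.
Context {R : realType} {T : metricType R} {G : groupType} {X : Type}.
Context (actX : G -> X -> X) (act : G -> T -> T) (conv : (R -> T) -> X -> Prop).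
Context (bd : boundary actX act conv).
Context (two_trans : forall U A U' A', U <> A -> U' <> A' ->
  exists g, actX g U = U' /\ actX g A = A').
Context (third : forall U A : X, exists B, B <> U /\ B <> A).
Implicit Types (E U A B V W : X) (g h k s : G) (x : T) (p q r L : R -> T).
Implicit Types (a b c : R).

Lemma same_direction_refl x E : same_direction conv x E E.
Proof.
by have [p pE p0] := ray_at bd x E; exists p, p, 1; split=> //; split.
Qed.

Lemma same_direction_sym x E E' :
  same_direction conv x E E' -> same_direction conv x E' E.
Proof.
by move=> [p [q [e [? ? ? ? [? ?]]]]]; exists q, p, e; split=> //; split.
Qed.

Lemma projection_pos_same_direction L U A B b : joins conv L U A ->
  projects conv L B b -> 0 < b -> same_direction conv (L 0) B A.
Proof.
move=> jL [r rB br] b0; have := joins_shift bd (- b) (joins_branch bd jL rB br).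
move=> [_ _ KB]; have [_ _ LA] := jL.
exists (fun t => if t - b <= 0 then L (b + (t - b)) else r (t - b)), L, b.
split; first exact: KB.
- exact: LA.
- by rewrite add0r ifT; [congr L; lra|lra].
- by [].
- by split=> //; rewrite subrr lexx addr0.
Qed.

Lemma projection_neq0_same_direction L U A B b : joins conv L U A ->
  projects conv L B b -> b != 0 ->
  same_direction conv (L 0) B A \/ same_direction conv (L 0) B U.
Proof.
move=> jL pB; case: (ltrgtP b 0) => // b0 _.
  right; rewrite -oppr0.
  by apply: (projection_pos_same_direction (joins_rev jL) (projects_rev pB)); lra.
by left; exact: (projection_pos_same_direction jL pB b0).
Qed.

(** Three ends in different directions at [x] have [x] as their median. *)
Lemma branching_projects x U A B : ~ same_direction conv x U A ->
  ~ same_direction conv x B U -> ~ same_direction conv x B A ->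
  exists L, [/\ joins conv L U A, L 0 = x, B <> U, B <> A
    & projects conv L B 0].
Proof.
move=> UA UB AB; have [L jL L0] := not_same_direction bd UA.
have BU : B <> U by move=> BU; apply: UB; rewrite BU; exact: same_direction_refl.
have BA : B <> A by move=> BA; apply: AB; rewrite BA; exact: same_direction_refl.
have [b pB] := projects_ex bd jL BU BA.
have [b0|b0] := eqVneq b 0; first by rewrite b0 in pB; exists L.
by have [] := projection_neq0_same_direction jL pB b0; rewrite L0.
Qed.

(** Without translations all ends have the same projection to a line, so the
    tree is a star and its ends are the directions at its centre. *)
Lemma ends_finite_of_no_shift : (forall x, finite_directions conv x) ->
  (forall g E c, shift act conv g E c -> c = 0) -> (exists U A : X, U <> A) ->
  exists n (e : X -> 'I_n), injective e.
Proof.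
move=> fin sh0 [U [A UA]]; have [B [BU BA]] := third U A.
have [L jL] := joins_ex bd UA; have [a pB] := projects_ex bd jL BU BA.
have prop g E c1 c2 : shift act conv g E c1 -> shift act conv g E c2 ->
    c2 = 0 * c1.
  by move=> _ /sh0 ->; rewrite mul0r.
have [n [D [_ DP]]] := fin (L a); exists n, D => E E' DE.
have nsd F F' : ~ same_direction conv (L a) F F' -> D F <> D F'.
  by move=> FF' /DP.
have DUA := nsd _ _ (joins_not_same_direction bd jL).
have [/nsd DUB /nsd DAB] := projects_not_same_direction bd jL pB.
have [F [F' [FE F'E FF']]] : exists F F',
    [/\ D F <> D E, D F' <> D E & D F <> D F'].
  have [UE|/eqP UE] := eqVneq (D U) (D E).
    by exists A, B; rewrite -UE; split=> //; exact: nesym.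
  have [AE|/eqP AE] := eqVneq (D A) (D E); last by exists U, A.
  by exists U, B; rewrite -AE; split=> //; exact: nesym.
apply: contrapT => EE'.
have neq V W : D V <> D W -> V <> W by move=> VW V_W; apply: VW; rewrite V_W.
have [|M jM M0] := @not_same_direction _ _ _ _ _ _ _ bd (L a) F E.
  by move=> /DP.
have F'F : D F' <> D F by exact: nesym.
have [b pF'] := projects_ex bd jM (neq _ _ F'F) (neq _ _ F'E).
have E'F : D E' <> D F by rewrite -DE; exact: nesym.
have [b' pE'] := projects_ex bd jM (neq _ _ E'F) (nesym EE').
have bb' : b' - b = 0.
  by rewrite (projections_proportional bd bd two_trans prop jM jM (neq _ _ F'F)
    (neq _ _ F'E) (neq _ _ E'F) (nesym EE') pF' pF' pE' pE') mul0r.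
have [b0|b0] := eqVneq b 0.
  have b'0 : b' = 0 by lra.
  rewrite b'0 in pE'; have [_] := projects_not_same_direction bd jM pE'.
  by rewrite M0 => /DP.
have [] := projection_neq0_same_direction jM pF' b0; rewrite M0 => /DP.
  exact: F'E.
exact: F'F.
Qed.

(** A hyperbolic element moves the ends off its axis along infinite orbits. *)
Lemma no_shift_of_ends_finite n (e : X -> 'I_n) : injective e ->
  forall g E c, shift act conv g E c -> c = 0.
Proof.
move=> einj g A c gA; apply/eqP/negPn/negP => c0.
have [U UA gU] := second_fixed_end bd gA c0.
have [L jL] := joins_ex bd UA; have gL := joins_shiftP bd jL gU gA.
have [B [BU BA]] := third U A; have [a pB] := projects_ex bd jL BU BA.
have pgB (k : nat) : projects conv L (actX (g ^+ k)%g B) (a + k%:R * c).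
  apply: (iffLR (projects_shift _ _ _ _ _)); have -> : (fun t => L (t + k%:R * c)) =
      (fun t => act (g ^+ k)%g (L t)).
    by apply/funext => t; rewrite (joins_actX bd k gL).
  exact: (projects_act bd).
have [v vP] := frequent_value (fun k : nat => e (actX (g ^+ k)%g B)).
have [i _ iv] := vP 0%N; have [j ij jv] := vP i.+1.
have E : actX (g ^+ i)%g B = actX (g ^+ j)%g B by apply: einj; rewrite iv jv.
have [lL _ _] := jL; have := pgB j; rewrite -E => pgj.
have := projects_uniq bd lL (pgB i) pgj.
move=> /addrI /(mulIf c0) /eqP; rewrite eqr_nat => /eqP ijE.
by rewrite ijE ltnn in ij.
Qed.

End Star.

(** * The isometry *)

Section Isometry.
Context {R : realType} {T1 T2 : metricType R} {G : groupType} {X : Type}.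
Context (actX : G -> X -> X) (act1 : G -> T1 -> T1) (act2 : G -> T2 -> T2).
Context (conv1 : (R -> T1) -> X -> Prop) (conv2 : (R -> T2) -> X -> Prop).
Context (bd1 : boundary actX act1 conv1) (bd2 : boundary actX act2 conv2).
Context (two_trans : forall U A U' A', U <> A -> U' <> A' ->
  exists g, actX g U = U' /\ actX g A = A').
Context (third : forall U A : X, exists B, B <> U /\ B <> A).
Context (two_ends : exists U A : X, U <> A).
Context (fin1 : forall x, finite_directions conv1 x).
Context (fin2 : forall x, finite_directions conv2 x).
Implicit Types (E U A B V W : X) (g : G).

(** The two shift homomorphisms are proportional, with the same factor for all
    ends. By two-transitivity it suffices to compare them on the stabilizer of
    one pair of ends. *)
Lemma shifts_proportional : exists2 l : R, 0 < l &
  forall g E c1 c2, shift act1 conv1 g E c1 -> shift act2 conv2 g E c2 ->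
    c2 = l * c1.
Proof.
have [U0 [A0 UA0]] := two_ends.
pose S c1 c2 := exists h, [/\ actX h U0 = U0, shift act1 conv1 h A0 c1
  & shift act2 conv2 h A0 c2].
have toS g E c1 c2 : shift act1 conv1 g E c1 -> shift act2 conv2 g E c2 ->
    S c1 c2.
  move=> g1 g2.
  have fixed V : V <> E -> actX g V = V -> S c1 c2.
    move=> VE gV; have [k [kV kE]] := two_trans VE UA0.
    exists (k * g * k^-1)%g; rewrite -kE; split.
    - by rewrite !(actXM bd1) -{1}kV (actXK bd1) gV.
    - exact: (shiftJ bd1).
    - exact: (shiftJ bd2).
  have [c10|c10] := eqVneq c1 0; last first.
    by have [V VE gV] := second_fixed_end bd1 g1 c10; exact: (fixed _ VE gV).
  have [c20|c20] := eqVneq c2 0; last first.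
    by have [V VE gV] := second_fixed_end bd2 g2 c20; exact: (fixed _ VE gV).
  by exists 1%g; rewrite (actX1 bd1) c10 c20; split=> //;
    [exact: (shift1 bd1)|exact: (shift1 bd2)].
have [no1|/existsNP[g1 /existsNP[E1 /existsNP[c1 /not_implyP[s1 c1n0]]]]] :=
    pselect (forall g E c, shift act1 conv1 g E c -> c = 0).
  exists 1 => // g E c1 c2 g1 g2.
  have [n [e einj]] := ends_finite_of_no_shift bd1 two_trans third fin1 no1 two_ends.
  by rewrite (no1 _ _ _ g1) (no_shift_of_ends_finite bd2 third einj g2) mulr0.
have [no2|/existsNP[g2 /existsNP[E2 /existsNP[c2 /not_implyP[s2 c2n0]]]]] :=
    pselect (forall g E c, shift act2 conv2 g E c -> c = 0).
  have [n [e einj]] := ends_finite_of_no_shift bd2 two_trans third fin2 no2 two_ends.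
  by case: c1n0; exact: (no_shift_of_ends_finite bd1 third einj s1).
have [d1 s1'] := shift_ex bd1 (shift_fix bd2 s2).
have [d2 s2'] := shift_ex bd2 (shift_fix bd1 s1).
have [|||||l l0 Sl] := @positively_proportional _ S.
- move=> a b a' b' [h [hU h1 h2]] [k [kU k1 k2]]; exists (h * k)%g; split.
  + by rewrite (actXM bd1) kU.
  + exact: (shiftM bd1).
  + exact: (shiftM bd2).
- move=> a b [h [hU h1 h2]]; exists h^-1%g; split.
  + exact: (actXV_fix bd1).
  + exact: (shiftV bd1).
  + exact: (shiftV bd2).
- move=> a b [h [hU h1 h2]].
  exact: (opposite_shifts_absurd bd1 bd2 two_trans third fin2 UA0 hU h1 h2).
- by exists c1, d2; split; [exact: (toS _ _ _ _ s1 s2')|exact/eqP].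
- by exists d1, c2; split; [exact: (toS _ _ _ _ s1' s2)|exact/eqP].
by exists l => // g E a b g1' g2'; apply: Sl; exact: (toS _ _ _ _ g1' g2').
Qed.

Context (l : R) (l0 : 0 < l).
Context (shift_prop : forall g E c1 c2,
  shift act1 conv1 g E c1 -> shift act2 conv2 g E c2 -> c2 = l * c1).

(** The lines [L1] and [L2] have the same ends, and all other ends project to
    corresponding points, up to the scaling by [l]. *)
Definition matched U A L1 L2 : Prop :=
  [/\ joins conv1 L1 U A, joins conv2 L2 U A & forall B a1 a2,
    B <> U -> B <> A -> projects conv1 L1 B a1 -> projects conv2 L2 B a2 ->
    a2 = l * a1].

(** It is enough to compare the projections of one end. *)
Lemma matched_of_projection U A B L1 L2 a : joins conv1 L1 U A ->
  joins conv2 L2 U A -> B <> U -> B <> A -> projects conv1 L1 B a ->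
  projects conv2 L2 B (l * a) -> matched U A L1 L2.
Proof.
move=> j1 j2 BU BA p1 p2; split=> // B' a1' a2' BU' BA' p1' p2'.
have := projections_proportional bd1 bd2 two_trans shift_prop j1 j2 BU BA
  BU' BA' p1 p2 p1' p2'.
by lra.
Qed.

Lemma matched_shift U A L1 L2 c : matched U A L1 L2 ->
  matched U A (fun t => L1 (t + c)) (fun t => L2 (t + l * c)).
Proof.
move=> [j1 j2 m]; split; [exact: (joins_shift bd1)|exact: (joins_shift bd2)|].
move=> B a1 a2 BU BA /projects_shift p1 /projects_shift p2.
by have := m _ _ _ BU BA p1 p2; lra.
Qed.

Lemma matched_rev U A L1 L2 : matched U A L1 L2 ->
  matched A U (fun t => L1 (- t)) (fun t => L2 (- t)).
Proof.
move=> [j1 j2 m]; split; [exact: joins_rev|exact: joins_rev|].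
move=> B a1 a2 BA BU q1 q2; have p1 := projects_rev q1; have p2 := projects_rev q2.
have oppK (T : Type) (L : R -> T) : (fun t => L (- - t)) = L.
  by apply/funext => t; rewrite opprK.
by rewrite oppK in p1; rewrite oppK in p2; have := m _ _ _ BU BA p1 p2; lra.
Qed.

Lemma matched_exr U A L1 : joins conv1 L1 U A -> exists L2, matched U A L1 L2.
Proof.
move=> j1; have UA := joins_neq bd1 j1; have [L j] := joins_ex bd2 UA.
have [B [BU BA]] := third U A.
have [a p1] := projects_ex bd1 j1 BU BA; have [b p2] := projects_ex bd2 j BU BA.
exists (fun t => L (t + (b - l * a))).
apply: (matched_of_projection j1 _ BU BA p1); first exact: (joins_shift bd2).
by apply: (iffRL (projects_shift _ _ _ _ _)); rewrite addrC subrK.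
Qed.

Lemma matched_exl U A L2 : joins conv2 L2 U A -> exists L1, matched U A L1 L2.
Proof.
move=> j2; have UA := joins_neq bd2 j2; have [L j] := joins_ex bd1 UA.
have [B [BU BA]] := third U A.
have [b p2] := projects_ex bd2 j2 BU BA; have [a p1] := projects_ex bd1 j BU BA.
exists (fun t => L (t + (a - b / l))).
apply: (matched_of_projection (a := b / l) _ j2 BU BA) => //.
- exact: (joins_shift bd1).
- by apply: (iffRL (projects_shift _ _ _ _ _)); rewrite addrC subrK.
- by rewrite mulrC divfK// gt_eqF.
Qed.

(** [y] is the point that corresponds to [x] if both are taken on the lines
    from [U] to [A]. *)
Definition corresponds_on U A x y : Prop :=
  exists L1 L2, [/\ matched U A L1 L2, L1 0 = x & L2 0 = y].

Lemma corresponds_on_rev U A x y :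
  corresponds_on U A x y -> corresponds_on A U x y.
Proof.
move=> [L1 [L2 [m L10 L20]]].
exists (fun t => L1 (- t)), (fun t => L2 (- t)).
by rewrite oppr0; split=> //; exact: matched_rev.
Qed.

Lemma corresponds_on_uniq U A x y y' :
  corresponds_on U A x y -> corresponds_on U A x y' -> y = y'.
Proof.
move=> [L1 [L2 [[j1 j2 m] L10 <-]]] [L1' [L2' [[j1' j2' m'] L10' <-]]].
have [c E1] := joins_uniq bd1 j1 j1'; have [d E2] := joins_uniq bd2 j2 j2'.
have c0 : c = 0.
  have := E1 0; rewrite L10 -L10' add0r => L'c; have [lL _ _] := j1'.
  by apply/esym; exact: (line_inj lL L'c).
rewrite (E2 0) add0r; congr L2'; have UA := joins_neq bd1 j1.
have [B [BU BA]] := third U A.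
have [a p1] := projects_ex bd1 j1 BU BA; have [b p2] := projects_ex bd2 j2 BU BA.
have L1E : L1 = L1' by apply/funext => t; rewrite E1 c0 addr0.
have L2E : L2 = (fun t => L2' (t + d)) by apply/funext.
have p1' := p1; rewrite L1E in p1'.
have p2' := p2; rewrite L2E in p2'; move/projects_shift in p2'.
have := m _ _ _ BU BA p1 p2; have := m' _ _ _ BU BA p1' p2'.
by lra.
Qed.

(** The lines from [U] to [A] and to [A'] agree up to the projection of [A'],
    in both trees and compatibly with the scaling; [x] lies on this common
    part. *)
Lemma corresponds_on_change U A A' x y : corresponds_on U A x y ->
  ~ same_direction conv1 x U A' -> corresponds_on U A' x y.
Proof.
move=> [L1 [L2 [m L10 L20]]] nUA'; have [j1 j2 mP] := m.
have [->|A'A] := pselect (A' = A); first by exists L1, L2.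
have A'U : A' <> U.
  by move=> E; apply: nUA'; rewrite E; exact: (same_direction_refl bd1 _ _).
have [a1 p1] := projects_ex bd1 j1 A'U A'A.
have [a2 p2] := projects_ex bd2 j2 A'U A'A.
have a2E := mP _ _ _ A'U A'A p1 p2.
have a10 : 0 <= a1.
  rewrite leNgt; apply/negP => a1n; apply: nUA'; rewrite -L10 -oppr0.
  apply: same_direction_sym.
  apply: (projection_pos_same_direction bd1 (joins_rev j1) (projects_rev p1)).
  by rewrite oppr_gt0.
have a20 : 0 <= a2 by rewrite a2E mulr_ge0// ltW.
have [r1 r1A' br1] := p1; have [r2 r2A' br2] := p2.
have k1 := joins_branch bd1 j1 r1A' br1; have q1 := projects_branch bd1 j1 r1A' br1.
have k2 := joins_branch bd2 j2 r2A' br2.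
have q2 : projects conv2 (fun t => if t <= 0 then L2 (a2 + t) else r2 t) A (l * 0).
  by rewrite mulr0; exact: (projects_branch bd2 j2 r2A' br2).
have AU : A <> U := nesym (joins_neq bd1 j1).
have mk := matched_of_projection k1 k2 AU (nesym A'A) q1 q2.
have := matched_shift (- a1) mk; rewrite mulrN -a2E => mk'.
eexists; eexists; split; first exact: mk'.
  by rewrite /= add0r ifT ?subrr//; lra.
by rewrite /= add0r ifT ?subrr//; lra.
Qed.

Lemma corresponds_on_joins U A x y :
  corresponds_on U A x y -> ~ same_direction conv1 x U A.
Proof.
by move=> [L1 [L2 [[j1 _ _] <- _]]]; exact: (joins_not_same_direction bd1 j1).
Qed.

(** Any two lines through [x] are related by replacing one end at a time, such
    that [x] stays on the line. *)
Lemma corresponds_on_indep U A U' A' x y y' :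
  corresponds_on U A x y -> corresponds_on U' A' x y' -> y = y'.
Proof.
move=> xy xy'; have nUA := corresponds_on_joins xy.
have nUA' := corresponds_on_joins xy'.
have [N [D [_ DP]]] := fin1 x.
have nDP E E' : D E <> D E' -> ~ same_direction conv1 x E E' by move=> H /DP.
have DUA : D U <> D A by move=> /DP.
have DUA' : D U' <> D A' by move=> /DP.
have last_step V : corresponds_on V A' x y -> y = y'.
  move=> /corresponds_on_rev /corresponds_on_change /(_ (nDP A' U' (nesym DUA'))).
  by move=> /corresponds_on_rev /corresponds_on_uniq; apply.
have [UA'|/eqP UA'] := eqVneq (D U) (D A').
  apply: (last_step A); apply: corresponds_on_change.
    exact: (corresponds_on_rev xy).
  by apply: nDP; rewrite -UA'; exact: nesym.
by apply: (last_step U); apply: corresponds_on_change xy _; exact: nDP.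
Qed.

Context (cover1 : forall x y : T1, exists U A L,
  [/\ joins conv1 L U A, L 0 = x & L (mdist x y) = y]).
Context (cover2 : forall x y : T2, exists U A L,
  [/\ joins conv2 L U A, L 0 = x & L (mdist x y) = y]).

(** [h] multiplies distances by [k] and maps rays to rays in the same element of
    [X]; the division by [k] restores the unit speed. *)
Definition homothety_over_ends (k : R) (h : T1 -> T2) : Prop :=
  (forall x y, mdist (h x) (h y) = k * mdist x y) /\
  forall p E, conv1 p E -> conv2 (fun t => h (p (t / k))) E.

Lemma homothety_exists : exists2 h : T1 -> T2,
  bijective h & homothety_over_ends l h.
Proof.
have /choice[h hP] x : exists y, exists U A, corresponds_on U A x y.
  have [U [A [L1 [j1 L10 _]]]] := cover1 x x.
  have [L2 m] := matched_exr j1; exists (L2 0), U, A, L1, L2; split=> //.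
have hE U A L1 L2 t : matched U A L1 L2 -> h (L1 t) = L2 (l * t).
  move=> m; have [V [B xy]] := hP (L1 t).
  apply: (corresponds_on_indep xy (U' := U) (A' := A)).
  eexists; eexists; split; first exact: (matched_shift t m).
    by rewrite /= add0r.
  by rewrite /= add0r.
have hd x y : mdist (h x) (h y) = l * mdist x y.
  have [U [A [L1 [j1 L10 L1d]]]] := cover1 x y; have [L2 m] := matched_exr j1.
  rewrite -{1}L10 -{1}L1d !(hE _ _ _ _ _ m) mulr0; have [_ [lL _ _] _] := m.
  by rewrite lL ?subr0// mulr_ge0 ?mdist_ge0 ?ltW.
have hinj x y : h x = h y -> x = y.
  move=> hxy; apply: mdist_positivity; apply: (mulfI (lt0r_neq0 l0)).
  by rewrite -hd hxy mdistxx mulr0.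
have hsurj y : exists x, h x = y.
  have [U [A [L2 [j2 L20 _]]]] := cover2 y y; have [L1 m] := matched_exl j2.
  by exists (L1 0); rewrite (hE _ _ _ _ _ m) mulr0.
exists h; last split=> // p E pE.
  have [h' h'K] := choice hsurj; exists h' => // x; exact: hinj.
have rp := conv_ray bd1 pE.
have [U [UE _]] := third E E; have [L1 j1] := joins_ex bd1 UE.
have [L2 m] := matched_exr j1; have [_ [_ _ L2E] _] := m; have [_ _ L1E] := j1.
have [c [M pL]] := conv_same_end bd1 pE L1E.
apply: (conv_asymptotic bd2 (c := l * c) L2E).
  move=> s t s0 st; rewrite hd rp.
  - by rewrite -mulrBl mulrCA divff ?mulr1// gt_eqF.
  - by rewrite divr_ge0// ltW.
  - by rewrite ler_pM2r ?invr_gt0.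
exists (M * l) => t Mt; rewrite pL ?ler_pdivlMr// (hE _ _ _ _ _ m).
by rewrite mulrDr mulrCA divff ?mulr1// gt_eqF.
Qed.

Lemma homothety_joins k h U A L : 0 < k -> homothety_over_ends k h ->
  joins conv1 L U A -> joins conv2 (fun t => h (L (t / k))) U A.
Proof.
move=> k0 [hd hc] [lL LU LA]; split.
- move=> s t st; rewrite hd lL ?ler_pM2r ?invr_gt0//.
  by rewrite -mulrBl mulrCA divff ?mulr1// gt_eqF.
- have := hc _ _ LU.
  by under eq_fun do rewrite -mulNr.
- exact: hc.
Qed.

Lemma homothety_projects k h B L a : 0 < k -> homothety_over_ends k h ->
  projects conv1 L B a -> projects conv2 (fun t => h (L (t / k))) B (k * a).
Proof.
move=> k0 [hd hc] [r rB [r0 br]]; exists (fun t => h (r (t / k))).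
  exact: hc.
have k1 : k * a / k = a by rewrite mulrAC divff ?mul1r// gt_eqF.
split=> [|s t s0 t0]; first by rewrite mul0r k1 r0.
have k2 u : k * (u / k) = u by rewrite mulrCA divff ?mulr1// gt_eqF.
have [s0' t0'] : 0 <= s / k /\ 0 <= t / k by rewrite !divr_ge0// ltW.
have [e1 e2] := br _ _ s0' t0'.
by rewrite mulrDl mulrBl k1 !hd e1 e2 mulrDr !k2.
Qed.

(** A homothety maps the median of three ends to the median of their images.
    Two medians determine its ratio, and then a median on each line determines
    it there. *)
Lemma homothety_uniq k h k' h' x y : 0 < k -> 0 < k' ->
  homothety_over_ends k h -> homothety_over_ends k' h' ->
  (exists U A B, [/\ ~ same_direction conv1 x U A,
     ~ same_direction conv1 x B U & ~ same_direction conv1 x B A]) ->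
  (exists U A B, [/\ ~ same_direction conv1 y U A,
     ~ same_direction conv1 y B U & ~ same_direction conv1 y B A]) ->
  x <> y -> h =1 h'.
Proof.
move=> k0 k'0 hk hk' bx y_br xy.
have at_branch z : (exists U A B, [/\ ~ same_direction conv1 z U A,
    ~ same_direction conv1 z B U & ~ same_direction conv1 z B A]) -> h z = h' z.
  move=> [U [A [B [UA BU BA]]]].
  have [L [jL <- BU' BA' pB]] := branching_projects bd1 UA BU BA.
  have j := homothety_joins k0 hk jL; have j' := homothety_joins k'0 hk' jL.
  have [c E] := joins_uniq bd2 j j'.
  have p := homothety_projects k0 hk pB; have p' := homothety_projects k'0 hk' pB.
  have pE : (fun t => h (L (t / k))) = (fun t => h' (L ((t + c) / k'))).
    exact/funext.
  rewrite pE in p; rewrite !mulr0 in p p'.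
  have := iffLR (projects_shift conv2 (fun t => h' (L (t / k'))) B 0 c) p.
  have [lj' _ _] := j'; move=> /(projects_uniq bd2 lj' p') c0.
  by have := E 0; rewrite (_ : c = 0) ?addr0 ?mul0r//; lra.
have hx := at_branch _ bx; have hy := at_branch _ y_br.
have kk' : k = k'.
  have [[hd _] [hd' _]] := (hk, hk').
  have := hd x y; rewrite hx hy hd' => /mulIf -> //.
  by apply/eqP => /mdist_positivity.
move=> z; have [U [A [L [jL <- _]]]] := cover1 z z.
have [B [BU BA]] := third U A; have [a pB] := projects_ex bd1 jL BU BA.
have j := homothety_joins k0 hk jL; have j' := homothety_joins k'0 hk' jL.
have [c E] := joins_uniq bd2 j j'.
have p := homothety_projects k0 hk pB; have p' := homothety_projects k'0 hk' pB.
have pE : (fun t => h (L (t / k))) = (fun t => h' (L ((t + c) / k'))).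
  exact/funext.
rewrite pE kk' in p.
have := iffLR (projects_shift conv2 (fun t => h' (L (t / k'))) B (k' * a) c) p.
have [lj' _ _] := j'; move=> /(projects_uniq bd2 lj' p') c0.
by have := E 0; rewrite (_ : c = 0) ?addr0 ?mul0r//; lra.
Qed.

End Isometry.

(** * Ends and directions as sets of rays *)

Section RayImages.
Context {R : realType} {T : metricType R}.
Implicit Types (x y : T) (p q r L : R -> T) (A B : set T) (c : R).

Definition ray_image p : set T := p @` `[0, +oo[.

(** The end represented by the ray [p]. *)
Definition end_of_ray p : set (set T) :=
  [set B | is_ray B /\ ray_equiv (ray_image p) B].

(** The direction at [x] represented by the ray [p]. *)
Definition direction_of_ray x p : set (set T) :=
  [set B | is_ray_from x B /\ locally_coincide x (ray_image p) B].

Lemma ray_imageP p v : ray_image p v <-> exists2 t, 0 <= t & p t = v.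
Proof.
split=> [[t /=]|[t t0 <-]]; last by exists t; rewrite //= in_itv /= t0.
by rewrite in_itv /= andbT => t0 <-; exists t.
Qed.

Lemma isometric_on_rayE p : isometric_on `[0, +oo[ p <-> ray p.
Proof.
split=> [iso s t s0 st|rp s t /=].
  rewrite iso /= ?in_itv /= ?andbT//; last exact: le_trans st.
  by rewrite ler0_norm ?opprB//; lra.
rewrite !in_itv /= !andbT => s0 t0; case: (lerP s t) => st.
  by rewrite rp// ler0_norm ?opprB//; lra.
by rewrite metric_sym rp ?ger0_norm//; lra.
Qed.

Lemma is_ray_fromP x A :
  is_ray_from x A <-> exists p, [/\ ray p, p 0 = x & A = ray_image p].
Proof. by split=> -[p [/isometric_on_rayE ? ? ?]]; exists p. Qed.

Lemma is_rayP A : is_ray A <-> exists2 p, ray p & A = ray_image p.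
Proof.
split=> [[x /is_ray_fromP[p [rp _ ->]]]|[p rp ->]]; first by exists p.
by exists (p 0); apply/is_ray_fromP; exists p.
Qed.

(** The parameter change is an isometric embedding of the half-line into itself,
    hence eventually a translation. *)
Lemma ray_image_sub r p : ray r -> ray p -> ray_image r `<=` ray_image p ->
  exists c, asymptotic c r p.
Proof.
move=> rr rp sub.
have /choice[u uP] t : exists u, 0 <= t -> 0 <= u /\ p u = r t.
  case: (lerP 0 t) => t0; last by exists 0.
  have /sub/ray_imageP[u u0 pu] : ray_image r (r t) by apply/ray_imageP; exists t.
  by exists u.
have [u0 pu0] := uP 0 (lexx 0).
exists (u 0), (u 0 + 1) => t tu; have t0 : 0 <= t by lra.
have [ut put] := uP t t0; rewrite -put; congr p.
have := rr 0 t (lexx 0) t0; rewrite -pu0 -put.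
case: (lerP (u 0) (u t)) => utu; first by rewrite rp//; lra.
by rewrite metric_sym rp//; lra.
Qed.

Context (tree : is_tree T).

(** Two rays that eventually coincide meet exactly in a ray, as geodesics are
    unique. *)
Lemma ray_equivP p q : ray p -> ray q ->
  ray_equiv (ray_image p) (ray_image q) <-> exists c, asymptotic c p q.
Proof.
move=> rp rq; split=> [/is_rayP[r rr E]|[c [M pq]]].
  have [|c rpc] := @ray_image_sub r p rr rp.
    by rewrite -E; exact: subIsetl.
  have [|d rqd] := @ray_image_sub r q rr rq.
    by rewrite -E; exact: subIsetr.
  by exists (- c + d); exact: asymptotic_trans (asymptotic_sym rpc) rqd.
pose N := Num.max (Num.max M 0) (- c).
have : N <= N by []; rewrite {1}/N !ge_max => /andP[/andP[MN N0] cN].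
have meet t u v : 0 <= t -> 0 <= u -> p t = q u -> t <= v ->
    u = t + c /\ p v = q (v + c).
  move=> t0 u0 ptu tv; pose w := Num.max N (Num.max v (`|u| - c)).
  have : w <= w by [].
  rewrite {1}/w !ge_max => /andP[/andP[/andP[Mw w0] cw] /andP[vw uw]].
  have uu := ler_norm u.
  have e1 := rp t w t0 ltac:(lra).
  have e2 := rq u (w + c) u0 ltac:(lra).
  have e3 := pq w Mw.
  rewrite -ptu -e3 in e2; have uE : u = t + c by lra.
  split=> //.
  have f1 := rp t v t0 tv; have f2 := rp v w (le_trans t0 tv) vw.
  have f3 := rq u (v + c) u0 ltac:(lra).
  have f4 := rq (v + c) (w + c) ltac:(lra) ltac:(lra).
  rewrite -ptu in f3; rewrite -e3 in f4.
  by apply: (between_uniq tree (x := p t) (y := p w)); lra.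
pose I := [set t | 0 <= t /\ ray_image q (p t)].
have IN : I N.
  split=> //; apply/ray_imageP; exists (N + c); first lra.
  by rewrite pq.
have infI : has_inf I by split; [exists N|exists 0 => t []].
pose a := inf I.
have a0 : 0 <= a by apply: lb_le_inf => [|t []//]; exists N.
have aP t : I t -> a <= t /\ (0 <= t + c /\ p t = q (t + c)).
  move=> It; split; first exact: inf_lbound (proj2 infI) _ It.
  by case: It => t0 /ray_imageP[u u0 /esym /(meet t u t t0 u0) /(_ (lexx t))[<-]].
have ac : 0 <= a + c.
  suff : - c <= a by lra.
  by apply: lb_le_inf => [|t /aP[_ [? _]]]; [exists N|lra].
have pqa : p a = q (a + c).
  apply: mdist_positivity; apply/eqP; rewrite eq_le mdist_ge0 andbT.
  rewrite leNgt; apply/negP => e0.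
  have e2 : 0 < mdist (p a) (q (a + c)) / 2 by lra.
  have [t It ta] := inf_adherent e2 infI; rewrite -/a in ta.
  have [at_ [tc pqt]] := aP t It.
  have tr := metric_triangle (p a) (p t) (q (a + c)).
  have d1 := rp a t a0 at_.
  have d2 : mdist (p t) (q (a + c)) = t - a by rewrite pqt metric_sym rq; lra.
  lra_absurd R.
apply/is_rayP; exists (fun t => p (t + a)); first exact: ray_shift.
apply/seteqP; split=> v.
  move=> [/ray_imageP[t t0 <-] qt]; have [at_ _] := aP t (conj t0 qt).
  by apply/ray_imageP; exists (t - a); rewrite ?subrK//; lra.
move=> /ray_imageP[t t0 <-].
have [_ E] := meet a (a + c) (t + a) a0 ac pqa ltac:(lra).
split; apply/ray_imageP; first by exists (t + a) => //; lra.
by exists (t + a + c); [lra|rewrite E].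
Qed.

Lemma end_of_rayP p q : ray p -> ray q ->
  end_of_ray p (ray_image q) <-> exists c, asymptotic c p q.
Proof.
move=> rp rq; split=> [[_ /(ray_equivP rp rq)]//|pq].
by split; [apply/is_rayP; exists q|apply/ray_equivP].
Qed.

Lemma endsP E : ends T E <-> exists2 p, ray p & E = end_of_ray p.
Proof.
split=> [[A /is_rayP[p rp ->] ->]|[p rp ->]]; first by exists p.
by exists (ray_image p) => //; apply/is_rayP; exists p.
Qed.

Lemma end_of_ray_eq c p q : ray p -> ray q -> asymptotic c p q ->
  end_of_ray p = end_of_ray q.
Proof.
move=> rp rq pq; apply/seteqP; split=> B [/is_rayP[r rr ->]].
  move=> /(ray_equivP rp rr)[d pr]; apply/end_of_rayP => //.
  by exists (- c + d); exact: asymptotic_trans (asymptotic_sym pq) pr.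
move=> /(ray_equivP rq rr)[d qr]; apply/end_of_rayP => //.
by exists (c + d); exact: asymptotic_trans pq qr.
Qed.

Lemma ends_eq E p : ends T E -> ray p -> E (ray_image p) -> E = end_of_ray p.
Proof.
move=> /endsP[q rq ->] rp /(end_of_rayP rq rp)[c qp].
exact: end_of_ray_eq rq rp qp.
Qed.

Lemma agree_before p q e t : ray p -> ray q -> p 0 = q 0 -> p e = q e ->
  0 <= t -> t <= e -> p t = q t.
Proof.
move=> rp rq pq0 pqe t0 te.
have e1 := rp 0 t (lexx 0) t0; have e2 := rp t e t0 te.
have e3 := rq 0 t (lexx 0) t0; have e4 := rq t e t0 te.
have e5 := rp 0 e (lexx 0) (le_trans t0 te).
rewrite -pq0 in e3; rewrite -pqe in e4.
by apply: (between_uniq tree (x := p 0) (y := p e)); lra.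
Qed.

Lemma locally_coincideP p q : ray p -> ray q -> p 0 = q 0 ->
  locally_coincide (p 0) (ray_image p) (ray_image q) <->
  exists e, 0 < e /\ p e = q e.
Proof.
move=> rp rq pq0; split=> [H|[e [e0 pqe]] E]; last first.
  have : (ray_image p `&` ray_image q) (p e).
    by split; apply/ray_imageP; exists e => //; exact: ltW.
  by rewrite E => /(ray_inj rp (ltW e0) (lexx 0)); lra.
apply: contrapT => nH; apply: H; apply/seteqP; split=> [v|v ->]; last first.
  by split; apply/ray_imageP; exists 0.
move=> [/ray_imageP[s s0 <-] /ray_imageP[t t0 qt]].
have e1 := rp 0 s (lexx 0) s0; have e2 := rq 0 t (lexx 0) t0.
rewrite qt -pq0 in e2; have ts : t = s by lra.
have [->//|sn0] := eqVneq s 0; case: nH; exists s.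
by rewrite -{3}ts qt lt0r sn0.
Qed.

Lemma direction_of_ray_eq p q : ray p -> ray q -> p 0 = q 0 ->
  direction_of_ray (p 0) p = direction_of_ray (p 0) q <->
  exists e, 0 < e /\ p e = q e.
Proof.
have trans (p1 p2 r : R -> T) e : ray p1 -> ray p2 -> ray r -> p1 0 = p2 0 ->
    p2 0 = r 0 -> 0 < e -> p1 e = p2 e ->
    (exists e', 0 < e' /\ p2 e' = r e') -> exists e', 0 < e' /\ p1 e' = r e'.
  move=> r1 r2 rr E1 E2 e0 pe [d [d0 qd]]; exists (Num.min e d).
  have m0 : 0 < Num.min e d by rewrite lt_min e0.
  split=> //; rewrite (agree_before r1 r2 E1 pe) ?(ltW m0) ?ge_min ?lexx//.
  by rewrite (agree_before r2 rr E2 qd) ?(ltW m0) ?ge_min ?lexx ?orbT.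
move=> rp rq pq0; split=> [E|[e [e0 pqe]]].
  have : direction_of_ray (p 0) q (ray_image q).
    rewrite pq0; split; first by apply/is_ray_fromP; exists q.
    by apply/locally_coincideP => //; exists 1.
  by rewrite -E => -[_ /locally_coincideP]; apply.
apply/seteqP; split=> B [/is_ray_fromP[r [rr r0 ->]]].
  move=> /(locally_coincideP rp rr (esym r0)) pr; split.
    by apply/is_ray_fromP; exists r.
  rewrite pq0; apply/(locally_coincideP rq rr); first by rewrite -pq0.
  by apply: (trans q p r e) => //.
rewrite pq0 => /(locally_coincideP rq rr (etrans (esym pq0) (esym r0))) qr.
split; first by apply/is_ray_fromP; exists r; rewrite -pq0.
rewrite -pq0; apply/(locally_coincideP rp rr) => //.
by apply: (trans p q r e) => //; rewrite -pq0.
Qed.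

End RayImages.

(** A homothety maps the class of a ray to the class of its image. *)
Lemma end_map_homothety (R : realType) (T T' : metricType R) (k : R)
    (h : T -> T') (p : R -> T) : is_tree T -> is_tree T' -> 0 < k ->
  (forall y, exists x, h x = y) ->
  (forall x y, mdist (h x) (h y) = k * mdist x y) -> ray p ->
  ray (fun t => h (p (t / k))) /\
  end_map h (end_of_ray p) = end_of_ray (fun t => h (p (t / k))).
Proof.
move=> tree tree' k0 hsurj hd rp.
have k1 u : k * (u / k) = u by rewrite mulrCA divff ?mulr1// gt_eqF.
have k2 u : k * u / k = u by rewrite mulrAC divff ?mul1r// gt_eqF.
have rayh q : ray q -> ray (fun t => h (q (t / k))).
  move=> rq s t s0 st; rewrite hd rq ?divr_ge0 ?(ltW k0)//.
    by rewrite -mulrBl k1.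
  by rewrite ler_pM2r ?invr_gt0.
have imh q : h @` ray_image q = ray_image (fun t => h (q (t / k))).
  apply/seteqP; split=> v.
    move=> [_ /ray_imageP[t t0 <-] <-]; apply/ray_imageP.
    by exists (k * t); rewrite ?k2// mulr_ge0// ltW.
  move=> /ray_imageP[t t0 <-]; exists (q (t / k)) => //.
  by apply/ray_imageP; exists (t / k); rewrite ?divr_ge0// ltW.
have [h' h'K] := choice hsurj.
have h'd x y : mdist (h' x) (h' y) = k^-1 * mdist x y.
  by rewrite -{2}(h'K x) -{2}(h'K y) hd mulrA mulVf ?mul1r// gt_eqF.
split; first exact: rayh.
apply/seteqP; split=> B.
  move=> [_ [/is_rayP[q rq ->] /(ray_equivP tree rp rq)[c [M pq]]] <-].
  rewrite imh; apply/end_of_rayP; [by []|exact: rayh|exact: rayh|].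
  exists (k * c), (k * M) => t Mt; rewrite pq; last by rewrite ler_pdivlMr// mulrC.
  by rewrite mulrDl k2.
move=> [/is_rayP[q rq ->] /(ray_equivP tree' (rayh p rp) rq)[c [M pq]]].
have rq' : ray (fun t => h' (q (k * t))).
  move=> s t s0 st; rewrite h'd rq ?mulr_ge0 ?(ltW k0)//.
    by rewrite -mulrBr mulrA mulVf ?mul1r// gt_eqF.
  by rewrite ler_pM2l.
exists (ray_image (fun t => h' (q (k * t)))).
  apply/end_of_rayP => //; exists (c / k), (M / k) => t.
  rewrite ler_pdivrMr// mulrC => Mt; rewrite mulrDr k1 -pq// k2.
  apply: mdist_positivity; apply: (mulfI (lt0r_neq0 k0)).
  by rewrite -hd h'K mdistxx mulr0.
rewrite imh; congr ray_image; apply/funext => t.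
by rewrite h'K k1.
Qed.

Lemma end_map_act (R : realType) (T : metricType R) (G : groupType)
    (act : G -> T -> T) g (p : R -> T) : is_tree T -> is_isometric_action act ->
  ray p -> ray (fun t => act g (p t)) /\
  end_map (act g) (end_of_ray p) = end_of_ray (fun t => act g (p t)).
Proof.
move=> tree action rp.
have [] := @end_map_homothety _ _ _ 1 (act g) p tree tree ltr01.
- by move=> y; exists (act g^-1%g y); rewrite -(act_mul action) mulgV act_one.
- by move=> x y; rewrite mul1r (act_mdist action).
- by [].
have -> // : (fun t => act g (p (t / 1))) = (fun t => act g (p t)).
by apply/funext => t; rewrite divr1.
Qed.

Lemma ends_act (R : realType) (T : metricType R) (G : groupType)
    (act : G -> T -> T) g E : is_tree T -> is_isometric_action act ->
  ends T E -> ends T (end_map (act g) E).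
Proof.
move=> tree action /endsP[p rp ->]; have [rgp ->] := end_map_act g tree action rp.
by apply/endsP; exists (fun t => act g (p t)).
Qed.

Lemma three_elements (Y : Type) (S : set Y) : `I_3 #<= S ->
  exists a b c, [/\ S a, S b & S c] /\ [/\ a <> b, a <> c & b <> c].
Proof.
move=> /card_leP[f].
have e n (n3 : (n < 3)%N) : exists m : `I_3, val m = n.
  by exists (SigSub (mem_set (n3 : `I_3 n))).
have [i i0] := e 0%N isT; have [j j1] := e 1%N isT; have [k k2] := e 2%N isT.
have fi m n : val (f m) = val (f n) -> val m = val n.
  by move=> /val_inj E; congr val; apply: (@inj _ _ _ f); rewrite ?inE.
exists (val (f i)), (val (f j)), (val (f k)).
split; first by split; exact: set_valP.
by split=> /fi; rewrite ?i0 ?j1 ?k2.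
Qed.

(** * The ends of a tree as an abstract boundary *)

(** In this section [phi] is an equivariant bijection from [X] to the set of
    ends of [T]. *)
Section Model.
Context {R : realType} {T : metricType R} {G : groupType} {X : Type}.
Context (actX : G -> X -> X) (act : G -> T -> T) (phi : X -> set (set T)).
Context (tree : is_tree T) (action : is_isometric_action act).
Context (phi_inj : injective phi) (phi_ends : forall e, ends T (phi e)).
Context (phi_surj : forall E, ends T E -> exists e, phi e = E).
Context (phi_act : forall g e, phi (actX g e) = end_map (act g) (phi e)).

(** The ray [p] lies in the end labelled by [e]. *)
Definition converges_to (p : R -> T) (e : X) : Prop :=
  ray p /\ phi e (ray_image p).

Lemma converges_toP p e : converges_to p e <-> ray p /\ phi e = end_of_ray p.
Proof.
split=> -[rp pe]; split=> //; first exact: ends_eq (phi_ends e) rp pe.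
by rewrite pe; apply/end_of_rayP => //; exists 0; exact: asymptotic_refl.
Qed.

Lemma ends_boundary : boundary actX act converges_to.
Proof.
split=> //.
- by move=> p e [].
- move=> e; have /endsP[p rp pe] := phi_ends e.
  by exists p; apply/converges_toP.
- move=> p rp; have [|e pe] := phi_surj (E := end_of_ray p).
    by apply/endsP; exists p.
  by exists e; apply/converges_toP.
- move=> p q c e /converges_toP[rp pe] rq qp; apply/converges_toP; split=> //.
  by rewrite pe; apply/esym; have := end_of_ray_eq tree rq rp qp; apply.
- move=> p q e /converges_toP[rp pe] [rq]; rewrite pe.
  by move=> /(end_of_rayP tree rp rq).
- move=> p e e' /converges_toP[_ pe] /converges_toP[_ pe'].
  by apply: phi_inj; rewrite pe pe'.
- move=> g p e /converges_toP[rp pe]; apply/converges_toP.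
  by rewrite phi_act pe; exact: end_map_act.
Qed.

Let bd := ends_boundary.

Lemma ends_finite_directions : tree_locally_finite T ->
  forall x, finite_directions converges_to x.
Proof.
move=> fin x; have /finite_seqP[s0 dirE] := fin x.
have /choice[p pP] e : exists p, converges_to p e /\ p 0 = x.
  by have [p ? ?] := ray_at bd x e; exists p.
pose d e := direction_of_ray x (p e); pose s := undup s0.
have dP (q : R -> T) : ray q -> q 0 = x -> direction_of_ray x q \in s.
  move=> rq q0; rewrite mem_undup.
  have : directions x (direction_of_ray x q).
    by exists (ray_image q) => //; apply/is_ray_fromP; exists q.
  by rewrite dirE.
have ds e : (index (d e) s < size s)%N.
  by rewrite index_mem; have [[rp _] p0] := pP e; exact: dP.
have dE q e : converges_to q e -> q 0 = x -> direction_of_ray x q = d e.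
  move=> qe q0; have [pe p0] := pP e; have [[rq _] [rp _]] := (qe, pe).
  rewrite /d -q0; apply/direction_of_ray_eq => //; first by rewrite q0.
  by exists 1; split=> //; apply: (ray_uniq bd qe pe); rewrite ?q0.
exists (size s), (fun e => Ordinal (ds e)); split=> [i|e e'].
  have : directions x (nth set0 s i).
    by rewrite dirE /= -mem_undup mem_nth.
  move=> [A /is_ray_fromP[q [rq q0 ->]] iE].
  have [e qe] := ray_conv bd rq; exists e; apply/val_inj => /=.
  rewrite -(dE _ _ qe q0) -[direction_of_ray _ _]iE index_uniq//.
  exact: undup_uniq.
have [[rp pe] p0] := pP e; have [[rp' pe'] p'0] := pP e'.
have <- : d e = d e' <-> same_direction converges_to x e e'.
  rewrite /d -p0; have -> := direction_of_ray_eq tree rp rp' (etrans p0 (esym p'0)).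
  split=> [[a [a0 pa]]|[q [q' [a [qe qe' q0 q'0 [a0 qa]]]]]].
    by exists (p e), (p e'), a; split=> //; rewrite p0.
  exists a; split=> //.
  rewrite -(ray_uniq bd qe (conj rp pe) _ (ltW a0)) ?q0//.
  by rewrite -(ray_uniq bd qe' (conj rp' pe') _ (ltW a0)) ?q'0// p0.
split=> [/(congr1 val) /= E|E]; last by apply/val_inj; rewrite /= E.
have dK a : nth set0 s (index (d a) s) = d a by rewrite nth_index// -index_mem.
by rewrite -(dK e) E dK.
Qed.

Lemma branch_point_ends x : branch_point x -> exists U A B,
  [/\ ~ same_direction converges_to x U A, ~ same_direction converges_to x B U
    & ~ same_direction converges_to x B A].
Proof.
move=> /three_elements[D0 [D1 [D2 [[[A0 /is_ray_fromP[p [rp p0 ->]] ->]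
  [A1 /is_ray_fromP[q [rq q0 ->]] ->] [A2 /is_ray_fromP[r [rr r0 ->]] ->]]]]]].
move=> [D01 D02 D12].
have [U pU] := ray_conv bd rp; have [A qA] := ray_conv bd rq.
have [B rB] := ray_conv bd rr; exists U, A, B.
have key (p1 p2 : R -> T) e1 e2 : converges_to p1 e1 -> converges_to p2 e2 ->
    p1 0 = x -> p2 0 = x -> direction_of_ray x p1 <> direction_of_ray x p2 ->
    ~ same_direction converges_to x e1 e2.
  move=> c1 c2 p10 p20 ne [q1 [q2 [a [c1' c2' q10 q20 [a0 qa]]]]]; apply: ne.
  have [[r1 _] [r2 _]] := (c1, c2).
  rewrite -p10; apply/(direction_of_ray_eq tree r1 r2); first by rewrite p10.
  exists a; split=> //.
  rewrite -(ray_uniq bd c1' c1 _ (ltW a0)) ?q10//.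
  by rewrite -(ray_uniq bd c2' c2 _ (ltW a0)) ?q20.
split; [exact: (key p q)|apply: (key r p) => //|apply: (key r q) => //];
  exact: nesym.
Qed.

Lemma leafless_lines : leafless T -> forall x y, exists U A L,
  [/\ joins converges_to L U A, L 0 = x & L (mdist x y) = y].
Proof.
move=> lf x y; have [S [xyS _]] := tree_geodesic tree x y.
have [|K [p [iso ->]] SK] := lf S; first by exists x, y.
have [x_in y_in] : S x /\ S y.
  move: xyS => [q [_ q0 ql ->]]; have xy0 := mdist_ge0 x y.
  by split; [exists 0|exists (mdist x y)]; rewrite //= in_itv /= ?lexx ?xy0.
have [a _ pa] := SK _ x_in; have [b _ pb] := SK _ y_in.
have lp : line p.
  by move=> s t st; rewrite iso// ler0_norm ?opprB//; lra.
have main L : line L -> exists U A, joins converges_to L U A.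
  move=> lL; have [U LU] := ray_conv bd (line_ray (line_rev lL)).
  by have [A LA] := ray_conv bd (line_ray lL); exists U, A.
case: (lerP a b) => ab.
  have [U [A j]] := main _ (line_shift a lp); exists U, A, (fun t => p (t + a)).
  by split=> //; rewrite ?add0r// -{1}pa -{1}pb lp// subrK.
have [U [A j]] := main _ (line_rev (line_shift a lp)).
exists U, A, (fun t => p (- t + a)); split=> //; first by rewrite oppr0 add0r.
by rewrite -{1}pa -{1}pb metric_sym lp ?(ltW ab)// -[RHS]pb; congr p; lra.
Qed.

End Model.

(** * The theorem *)

Unset Implicit Arguments.

Theorem mainTheorem1 (R : realType) (G : groupType) (T1 T2 : metricType R)
    (act1 : G -> T1 -> T1) (act2 : G -> T2 -> T2)
    (f : set (set T1) -> set (set T2))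
    (tree1 : is_tree T1) (tree2 : is_tree T2)
    (leafless1 : leafless T1) (leafless2 : leafless T2)
    (action1 : is_isometric_action act1) (action2 : is_isometric_action act2)
    (f_bij : set_bij (ends T1) (ends T2) f)
    (f_equivariant : forall g E, ends T1 E ->
       f (end_map (act1 g) E) = end_map (act2 g) (f E))
    (finite1 : tree_locally_finite T1) (finite2 : tree_locally_finite T2)
    (three_ends1 : `I_3 #<= ends T1) (three_ends2 : `I_3 #<= ends T2)
    (two_transitive : two_transitive_on_ends act1) :
  exists (c : R) (fbar : T1 -> T2),
    [/\ 0 < c,
        is_isometry (@mdist R T1) (@rescale R T2 c) fbar,
        induces_on_ends fbar f
      & (exists x y : T1, [/\ branch_point x, branch_point y & x <> y]) ->
        forall (c' : R) (fbar' : T1 -> T2), 0 < c' ->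
          is_isometry (@mdist R T1) (@rescale R T2 c') fbar' ->
          induces_on_ends fbar' f ->
          fbar' =1 fbar].
Proof.
have [f_ends f_inj f_surj] := f_bij.
(* The ends of [T1] serve as boundary of both trees, through [f] for [T2]. *)
pose X := {E : set (set T1) | ends T1 E}.
pose actX g (e : X) : X :=
  exist _ (end_map (act1 g) (sval e)) (ends_act g tree1 action1 (svalP e)).
have sval_inj : injective (fun e : X => sval e).
  by move=> [E HE] [E' HE'] /= EE'; exact: eq_exist.
pose conv1 := converges_to (fun e : X => sval e).
pose conv2 := converges_to (fun e : X => f (sval e)) (T := T2).
have surj1 E : ends T1 E -> exists e : X, sval e = E.
  by move=> HE; exists (exist _ E HE).
have inj2 : injective (fun e : X => f (sval e)).
  by move=> e e' ee'; apply: sval_inj; apply: f_inj ee'; rewrite inE; exact: svalP.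
have ends2 (e : X) : ends T2 (f (sval e)) by apply: f_ends; exact: svalP.
have surj2 E : ends T2 E -> exists e : X, f (sval e) = E.
  by move=> /f_surj[E' HE' <-]; exists (exist _ E' HE').
have act2E g (e : X) : f (sval (actX g e)) = end_map (act2 g) (f (sval e)).
  by apply: f_equivariant; exact: svalP.
have ends1 (e : X) : ends T1 (sval e) by exact: svalP.
have act1E g (e : X) : sval (actX g e) = end_map (act1 g) (sval e) by [].
have bd1 : boundary actX act1 conv1 by exact: ends_boundary.
have bd2 : boundary actX act2 conv2 by exact: ends_boundary.
have two_trans (U A U' A' : X) : U <> A -> U' <> A' ->
    exists g, actX g U = U' /\ actX g A = A'.
  move=> UA UA'; have [||g [gU gA]] := two_transitive (sval U) (sval A) (sval U')
    (sval A') (svalP U) (svalP A) (svalP U') (svalP A').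
  - by move=> /sval_inj.
  - by move=> /sval_inj.
  by exists g; split; exact: sval_inj.
have [E0 [E1 [E2 [[H0 H1 H2] [E01 E02 E12]]]]] := three_elements three_ends1.
pose e0 : X := exist _ E0 H0; pose e1 : X := exist _ E1 H1.
pose e2 : X := exist _ E2 H2.
have e01 : e0 <> e1 by move=> /(congr1 sval).
have e02 : e0 <> e2 by move=> /(congr1 sval).
have e12 : e1 <> e2 by move=> /(congr1 sval).
have third (U A : X) : exists B, B <> U /\ B <> A.
  have [<-|U0] := pselect (e0 = U).
    have [<-|A1] := pselect (e1 = A); first by exists e2; split; exact: nesym.
    by exists e1; split=> //; exact: nesym.
  have [<-|A0] := pselect (e0 = A); last by exists e0.
  have [<-|U1] := pselect (e1 = U); first by exists e2; split; exact: nesym.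
  by exists e1; split=> //; exact: nesym.
have two_ends : exists U A : X, U <> A by exists e0, e1.
have fd1 : forall x, finite_directions conv1 x.
  exact: (ends_finite_directions tree1 action1 sval_inj ends1 surj1 act1E finite1).
have fd2 : forall x, finite_directions conv2 x.
  exact: (ends_finite_directions tree2 action2 inj2 ends2 surj2 act2E finite2).
have cover1 : forall x y : T1, exists U A L,
    [/\ joins conv1 L U A, L 0 = x & L (mdist x y) = y].
  exact: (leafless_lines tree1 action1 sval_inj ends1 surj1 act1E leafless1).
have cover2 : forall x y : T2, exists U A L,
    [/\ joins conv2 L U A, L 0 = x & L (mdist x y) = y].
  exact: (leafless_lines tree2 action2 inj2 ends2 surj2 act2E leafless2).
have [l l0 shift_prop] :=
  shifts_proportional bd1 bd2 two_trans third two_ends fd1 fd2.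
have [h hbij hh] := homothety_exists bd1 bd2 two_trans third fd1 l0 shift_prop
  cover1 cover2.
have [hd hc] := hh.
exists l^-1, h; split.
- by rewrite invr_gt0.
- by split=> // x y; rewrite /rescale hd mulrA mulVf ?mul1r// gt_eqF.
- move=> E HE; have /endsP[p rp pE] := HE.
  have hsurj y : exists x, h x = y by case: hbij => h' _ h'K; exists (h' y).
  have [rhp] := end_map_homothety tree1 tree2 l0 hsurj hd rp; rewrite pE => ->.
  have pe : conv1 p (exist _ E HE).
    exact: (iffRL (converges_toP tree1 ends1 _ _)).
  have [_ /=] := hc _ _ pe; rewrite -pE => fE.
  by apply/esym; apply: ends_eq => //; exact: f_ends.
move=> [x [y [bx y_br xy]]] c' h' c'0 [h'bij h'd] h'f.
have hh' : homothety_over_ends conv1 conv2 c'^-1 h'.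
  have k0 : 0 < c'^-1 by rewrite invr_gt0.
  have h'd' u v : mdist (h' u) (h' v) = c'^-1 * mdist u v.
    by rewrite -h'd /rescale mulrA mulVf ?mul1r// gt_eqF.
  split=> // p e pe; have h'surj z : exists w, h' w = z.
    by case: h'bij => k _ kK; exists (k z).
  have [rp pE] := iffLR (converges_toP tree1 ends1 p e) pe.
  have [rhp E] := end_map_homothety tree1 tree2 k0 h'surj h'd' rp.
  apply: (iffRL (converges_toP tree2 ends2 _ _)).
  by split=> //; rewrite -h'f; [rewrite pE|exact: ends1].
have k0 : 0 < c'^-1 by rewrite invr_gt0.
have median z (bz : branch_point z) :=
  branch_point_ends tree1 action1 sval_inj ends1 surj1 act1E bz.
apply: fsym; exact: (homothety_uniq bd1 bd2 third cover1 l0 k0 hh hh'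
  (median x bx) (median y y_br) xy).
Qed.
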